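(* Let $\mathcal{X}=(\mathcal{X}_e:e\in E_n)$ be distributions of edge weights of $K_n$ such that each $\mathcal{X}_e$ is supported on $[-1,1]$ and has its density function bounded from above by a parameter $\phi>0$, and let $X=(X_e)_{e\in E_n}$ be drawn independently with $X_e\sim\mathcal{X}_e$. Then with probability at least $1-o_n(1)$ over the draw of $X$, every implementation of the 2-FLIP algorithm (any initial configuration, any admissible pivoting rule) running on $K_n$ with edge weights $X$ terminates after at most $\phi\, n^{O(\log^{10} n)}$ steps.
   Context: $K_n=(V_n,E_n)$ is the complete graph on $V_n=[n]$. A configuration is $\gamma\in\{\pm1\}^n$, and its objective (cut weight) is $\mathrm{obj}_X(\gamma)=\sum_{\{u,v\}\in E_n}X_{\{u,v\}}\mathbf{1}\{\gamma(u)\neq\gamma(v)\}$. The 2-FLIP algorithm starts from an arbitrary configuration $\gamma$ and, while there exists a configuration $\gamma'$ differing from $\gamma$ in at most two coordinates with $\mathrm{obj}_X(\gamma')>\mathrm{obj}_X(\gamma)$, replaces $\gamma$ by one such $\gamma'$ chosen by a pivoting rule; a step is one such replacement. The pivoting rule is arbitrary except that it never flips a pair of nodes when flipping only one of those two nodes would yield a strictly larger objective. *)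

(* Defs.v *)
From HB Require Import structures.
From mathcomp Require Import all_boot all_order all_algebra.
From mathcomp Require Import all_classical all_reals all_analysis.

Set Implicit Arguments.
Unset Strict Implicit.
Unset Printing Implicit Defensive.

Import Order.TTheory GRing.Theory Num.Theory.
Import numFieldNormedType.Exports.

Local Open Scope classical_set_scope.
Local Open Scope ring_scope.

Notation edge n := {e : {set 'I_n} | #|e| == 2%N}.

(* The booleans encode the two signs +1 and -1. *)
Notation config n := {ffun 'I_n -> bool}.

Definition cut n (g : config n) (e : edge n) : bool :=
  [exists u in val e, exists v in val e, g u != g v].

Definition obj (R : realType) n (x : edge n -> R) (g : config n) : R :=
  \sum_(e : edge n) x e * (cut g e)%:R.

Definition diff n (g g' : config n) : {set 'I_n} :=
  [set u | g u != g' u]%SET.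

Definition flip1 n (u : 'I_n) (g : config n) : config n :=
  [ffun v => if v == u then ~~ g v else g v].

Definition improving2 (R : realType) n (x : edge n -> R) (g g' : config n) :
    bool :=
  (#|diff g g'| <= 2)%N && (obj x g < obj x g').

(* A pair is never flipped when flipping just one of its two nodes gives an
   objective strictly larger than flipping the pair. *)
Definition admissible_move (R : realType) n (x : edge n -> R)
    (g g' : config n) : bool :=
  (#|diff g g'| == 2%N) ==>
  [forall u in diff g g', ~~ (obj x g' < obj x (flip1 u g))].

Definition twoFLIP_step (R : realType) n (x : edge n -> R) : rel (config n) :=
  [rel g g' | improving2 x g g' && admissible_move x g g'].

(* Executions are the sequences of moves g, s_0, s_1, ... (with size s steps);
   quantifying over all of them covers every initial configuration and every
   admissible, possibly history-dependent or randomised, pivoting rule. *)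
Definition twoFLIP_terminates_within (R : realType) n (x : edge n -> R)
    (t : R) : Prop :=
  forall (g : config n) (s : seq (config n)),
    path (twoFLIP_step x) g s -> (size s)%:R <= t.

Definition has_density_bounded_by (R : realType)
    (mu : probability (measurableTypeR R) R) (phi : R) : Prop :=
  exists f : R -> R,
    [/\ measurable_fun setT f,
        (forall r, 0 <= f r <= phi) &
        (forall A : set R, measurable A ->
           mu A = (\int[lebesgue_measure]_(r in A) (f r)%:E)%E)].

Definition supported_on_unit (R : realType)
    (mu : probability (measurableTypeR R) R) : Prop :=
  mu `[-1, 1]%classic = 1%E.

(* Agreement is required on measurable sets only: measures are total functions
   on sets, with irrelevant values elsewhere. *)
Definition has_law (R : realType) d (T : measurableType d)
    (P : probability T R) (X : {RV P >-> R})
    (mu : probability (measurableTypeR R) R) : Prop :=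
  forall A : set R, measurable A -> distribution P X A = mu A.

Definition mutually_independent (R : realType) d (T : measurableType d)
    (P : probability T R) (I : finType) (X : I -> {RV P >-> R}) : Prop :=
  forall (J : {set I}) (A : I -> set R), (forall i, measurable (A i)) ->
    P (\bigcap_(i in [set` J]) (X i @^-1` A i)) =
    (\prod_(i in J) P (X i @^-1` A i))%E.

(* Main.v *)
(* Idea of the proof.  The configurations g_0, g_1, ... of a run are distinct,
   since the objective increases, and the objective is an affine combination,
   with coefficients X_e, of the Walsh functions walsh J g = prod_(v in J)
   (-1)^(g v) of the pairs J = e.  Hence an integer combination b of the
   configurations of a window of moves that annihilates all Walsh functions of
   degree at most one turns small gains into a small linear form in X, which
   depends only on the nodes that move in the window.  If the window carries r
   such forms in triangular position, they are all small with probability at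
   most (poly(n) phi eps)^r; since a window of m moves has (4n^2)^m codes, a union
   bound suffices as soon as r is at least m / polylog(n).

   To find the forms, choose a dyadic window in which a 1/log(n) fraction of the
   moves flips a node that is rare in this window, all nodes flipped by these
   moves being frequent in the window of double length.  Seen as edges between
   nodes (frequent nodes being cut into chunks of consecutive flips), these moves
   outnumber the vertices, so they contain a signed cycle, hence an affine
   relation a between configurations.  As the configurations are distinct, a
   minimal cycle cannot be balanced in each class of configurations agreeing on
   the rare nodes, so some Walsh function with at most one frequent node is not
   annihilated by a.  Splitting the least such one as K times a pair e, the
   relation a * walsh K yields a form with leading edge e, and e is incident to
   the cycle in a way that few moves share.  Discarding the moves close to the
   leading edges already found and repeating produces many leading edges. *)

Require Import Defs.
From mathcomp Require Import all_boot all_order all_algebra.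
From mathcomp Require Import boolp.
From mathcomp Require Import ring lra zify.

Set Implicit Arguments.
Unset Strict Implicit.
Unset Printing Implicit Defensive.

Import Order.TTheory GRing.Theory Num.Theory.

Local Open Scope ring_scope.

(** * Signed cycles in multigraphs *)

(** A matrix with more rows, indexed by [Q], than columns, indexed by [P], cannot have full row
    rank; a nonzero vector of its left kernel, extended by zero outside [Q], is the solution. *)
Lemma nontrivial_kernel (F : fieldType) (I W : finType) (Q : {set I})
    (P : {set W}) (A : I -> W -> F) :
  (#|P| < #|Q|)%N ->
  exists x : I -> F,
    [/\ exists i, x i != 0, forall i, i \notin Q -> x i = 0 &
        forall w, w \in P -> \sum_i x i * A i w = 0].
Proof.
move=> ltPQ.
pose M : 'M[F]_(#|Q|, #|P|) := \matrix_(i, j) A (enum_val i) (enum_val j).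
have : kermx M != 0.
  rewrite kermx_eq0 /row_free neq_ltn; apply/orP; left.
  exact: leq_ltn_trans (rank_leq_col M) ltPQ.
move=> /rowV0Pn[u /sub_kermxP uM /rV0Pn[j uj]].
pose x i := \sum_(k < #|Q| | enum_val k == i) u 0 k.
have xE k : x (enum_val k) = u 0 k.
  rewrite /x (big_pred1 k) // => k'; apply/eqP/eqP => [|->//].
  exact: enum_val_inj.
exists x; split; first by exists (enum_val j); rewrite xE.
  move=> i iQ; rewrite /x big_pred0 // => k.
  by apply: contraNF iQ => /eqP<-; exact: enum_valP.
move=> w wP.
have := congr1 (fun N : 'rV_#|P| => N 0 (enum_rank_in wP w)) uM.
rewrite !mxE => sum0; rewrite -[RHS]sum0.
rewrite (bigID (mem Q)) /= [X in _ + X]big1 ?addr0; last first.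
  move=> i iQ; rewrite /x big_pred0 ?mul0r // => k.
  by apply: contraNF iQ => /eqP<-; exact: enum_valP.
rewrite big_enum_val; apply: eq_bigr => k _.
by rewrite xE !mxE enum_rankK_in.
Qed.

Section Circulation.
Variables (I V : finType) (src dst : I -> V).

Definition boundary (R : pzRingType) (x : I -> R) (v : V) : R :=
  \sum_i x i * ((dst i == v)%:R - (src i == v)%:R).

Definition circulation (R : pzRingType) (x : I -> R) := forall v, boundary x v = 0.

(** Summation by parts. It converts conservation at the vertices into identities for cut indicators
    and for the signs of nodes. *)
Lemma sum_boundary_fun (R : pzRingType) (x : I -> R) (f : V -> R) :
  \sum_v boundary x v * f v = \sum_i x i * (f (dst i) - f (src i)).
Proof.
under eq_bigr do rewrite /boundary mulr_suml.
rewrite exchange_big; apply: eq_bigr => i _ /=.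
under eq_bigr do rewrite -mulrA mulrBl.
rewrite -mulr_sumr sumrB; congr (_ * (_ - _)).
  rewrite (bigD1 (dst i)) //= eqxx mul1r big1 ?addr0 // => v /negPf.
  by rewrite eq_sym => ->; rewrite mul0r.
rewrite (bigD1 (src i)) //= eqxx mul1r big1 ?addr0 // => v /negPf.
by rewrite eq_sym => ->; rewrite mul0r.
Qed.

Lemma sum_boundary (R : pzRingType) (x : I -> R) : \sum_v boundary x v = 0.
Proof.
have := sum_boundary_fun x (fun=> 1); under eq_bigr do rewrite mulr1.
by move=> ->; rewrite big1 // => i _; rewrite subrr mulr0.
Qed.

Definition adj (Q : pred I) : rel V := fun a b =>
  [exists i, Q i && ((src i == a) && (dst i == b) || (src i == b) && (dst i == a))].

(** Unit flow along a simple path, each edge being signed by the direction in which it is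
    traversed. *)
Lemma path_flow (Q : pred I) (a : V) (s : seq V) :
  path (adj Q) a s -> uniq (a :: s) ->
  exists c : I -> int,
    [/\ forall i, `|c i| <= 1,
        forall i, c i != 0 -> [&& Q i, src i \in a :: s & dst i \in a :: s] &
        forall v, boundary c v = (v == last a s)%:R - (v == a)%:R].
Proof.
elim: s a => [|b s IH] a.
  move=> _ _; exists (fun=> 0); split=> // v.
    by rewrite subrr /boundary big1 // => i _; rewrite mul0r.
move=> /= /andP[/existsP[g /andP[Qg ab]] bs] /andP[abs ubs].
have [c [c1 cQ cb]] := IH b bs ubs.
(* The new edge meets [a], which the rest of the path avoids. *)
have cg : c g = 0.
  apply/eqP; apply: contraNT abs => /cQ /and3P[_].
  by case/orP: ab => /andP[/eqP<- /eqP<-].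
pose s0 : int := if src g == a then 1 else -1.
exists (fun i => if i == g then s0 else c i); split => [i|i|v].
- by case: ifP => // _; rewrite /s0; case: ifP; rewrite ?normrN normr1.
- case: ifP => [/eqP-> _|_ /cQ /and3P[-> si di]]; last first.
    by rewrite inE si orbT inE di orbT.
  by rewrite Qg; case/orP: ab => /andP[/eqP-> /eqP->]; rewrite !inE !eqxx ?orbT.
- rewrite /boundary (bigD1 g) //= eqxx.
  have -> : \sum_(i | i != g) (if i == g then s0 else c i) *
      ((dst i == v)%:R - (src i == v)%:R) = boundary c v.
    rewrite /boundary [RHS](bigD1 g) //= cg mul0r add0r.
    by apply: eq_bigr => i /negPf->.
  rewrite cb -/(last b s).
  have -> : s0 * ((dst g == v)%:R - (src g == v)%:R) = (b == v)%:R - (a == v)%:R.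
    rewrite /s0; case/orP: ab => /andP[/eqP-> /eqP->]; rewrite ?eqxx ?mul1r //.
    case: (eqVneq b a) => [->|]; first by rewrite !subrr mulr0.
    by rewrite mulN1r opprB.
  by rewrite (eq_sym b) (eq_sym a) addrC addrA subrK.
Qed.

(* If removing an edge carrying flow disconnects its endpoints, the indicator
   of one side pairs to a nonzero multiple of that flow; otherwise a simple
   return path closes the edge into a signed cycle. *)
Lemma unit_circulation (R : idomainType) (x : I -> R) :
  circulation x -> (exists i, x i != 0) ->
  exists c : I -> int,
    [/\ forall i, `|c i| <= 1, exists i, c i != 0, circulation c &
        forall i, c i != 0 -> x i != 0].
Proof.
move=> xcirc [e xe].
pose Q i := (i != e) && (x i != 0).
have [con|ncon] := boolP (connect (adj Q) (src e) (dst e)).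
  case/connectP: con => s0 /shortenP[s ps us _] lasts.
  have [c [c1 cQ cb]] := path_flow ps us.
  have ce : c e = 0.
    by apply/eqP; apply: contraT => /cQ; rewrite /Q eqxx.
  exists (fun i => if i == e then -1 else c i); split=> [i||v|i].
  - by case: ifP => // _; rewrite normrN normr1.
  - by exists e; rewrite eqxx.
  - rewrite /boundary (bigD1 e) //= eqxx.
    have -> : \sum_(i | i != e) (if i == e then -1 else c i) *
        ((dst i == v)%:R - (src i == v)%:R) = boundary c v.
      rewrite /boundary [RHS](bigD1 e) //= ce mul0r add0r.
      by apply: eq_bigr => i /negPf->.
    by rewrite cb -lasts (eq_sym v) (eq_sym v) mulN1r addNr.
  - by case: ifP => [/eqP->//|_ /cQ /and3P[/andP[]]].
pose f v : R := (connect (adj Q) (src e) v)%:R.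
have := sum_boundary_fun x f.
rewrite big1 => [|v _]; last by rewrite xcirc mul0r.
rewrite (bigD1 e) //= big1 => [|i ie].
  rewrite /f connect0 (negPf ncon) sub0r mulrN1 addr0 => /eqP.
  by rewrite eq_sym oppr_eq0 (negPf xe).
have [->|xi] := eqVneq (x i) 0; first by rewrite mul0r.
have sym : connect_sym (adj Q).
  by apply: sym_connect_sym => a b; rewrite /adj; apply: eq_existsb => j; rewrite orbC.
rewrite /f.
have -> : connect (adj Q) (src e) (dst i) = connect (adj Q) (src e) (src i).
  apply: (same_connect_r sym); apply: connect1; apply/existsP; exists i.
  by rewrite /Q ie xi !eqxx orbT.
by rewrite subrr mulr0.
Qed.

End Circulation.

(** * Walsh functions on windows of moves *)

Section Characters.
Variable n : nat.
Implicit Types (J K : {set 'I_n}) (g : config n).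

Definition walsh J g : int := \prod_(v in J) (-1) ^+ g v.

Lemma walsh0 g : walsh set0 g = 1.
Proof. by rewrite /walsh big_set0. Qed.

Lemma walsh1 v g : walsh [set v] g = (-1) ^+ g v.
Proof. by rewrite /walsh big_set1. Qed.

Definition symd J K := (J :\: K) :|: (K :\: J).

Lemma walshM J K g : walsh J g * walsh K g = walsh (symd J K) g.
Proof.
rewrite /walsh big_mkcond [X in _ * X]big_mkcond [RHS]big_mkcond -big_split /=.
apply: eq_bigr => v _; rewrite !inE.
by case: (v \in J); case: (v \in K); case: (g v).
Qed.

Lemma normr_walsh J g : `|walsh J g| = 1.
Proof.
by rewrite /walsh normr_prod big1 // => v _; rewrite normr_sign.
Qed.

(** Expands a cylinder indicator in Walsh functions: one disagreement kills the product, and each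
    agreement contributes a factor 2. *)
Lemma prod_sign_agree (s : seq 'I_n) (y g : config n) :
  \prod_(u <- s) (1 + (-1) ^+ y u * (-1) ^+ g u) =
  2 ^+ size s * (all (fun u => g u == y u) s)%:R :> int.
Proof.
elim: s => [|u s IH]; first by rewrite big_nil mulr1.
rewrite big_cons IH /= exprS.
case: (g u); case: (y u) => /=; rewrite ?expr1 ?expr0 ?mulr1 ?mul1r ?mulN1r ?mulrN1 ?opprK; ring.
Qed.

End Characters.

(** * Windows of moves as graphs on chunks of nodes *)

Section Window.
Variables (n len D : nat) (gam : nat -> config n).
Hypothesis D_gt0 : (0 < D)%N.
Hypothesis gam_inj : forall s t, (s <= len)%N -> (t <= len)%N -> gam s = gam t -> s = t.

Definition flips t v := gam t v != gam t.+1 v.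
Definition occ v t := (\sum_(i < t) flips i v)%N.
(* Flips of a frequent node are cut into chunks of [D] consecutive ones, so that
   the cycles through it have bounded overlap in time; a node of [low] has a
   single chunk. *)
Definition chunk v t := (occ v t %/ D)%N.
Definition low := [set v | (occ v len <= D)%N].

Lemma occS v t : occ v t.+1 = (occ v t + flips t v)%N.
Proof. by rewrite /occ big_ord_recr. Qed.

Lemma occ_mono v s t : (s <= t)%N -> (occ v s <= occ v t)%N.
Proof.
move=> st; rewrite /occ (big_ord_widen t (fun i => (flips i v : nat)) st).
by rewrite [leqRHS](bigID (fun i : 'I_t => (i < s)%N)) leq_addr.
Qed.

Lemma occ_lt v (i : nat) : (i < len)%N -> flips i v -> (occ v i < occ v len)%N.
Proof. by move=> il fi; apply: leq_trans (occ_mono v il); rewrite occS fi addn1. Qed.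

Lemma chunk_mono v s t : (s <= t)%N -> (chunk v s <= chunk v t)%N.
Proof. by move=> st; rewrite leq_div2r // occ_mono. Qed.

Lemma chunk_low v (i : nat) : v \in low -> (i < len)%N -> flips i v -> chunk v i = 0%N.
Proof.
rewrite inE => vl il fi; rewrite /chunk divn_small //.
exact: leq_trans (occ_lt il fi) vl.
Qed.

Lemma occ_le v t : (occ v t <= t)%N.
Proof.
rewrite /occ -[leqRHS]card_ord -sum1_card leq_sum // => i _.
by rewrite leq_b1.
Qed.

Lemma chunk_lt v (i : nat) : (i <= len)%N -> (chunk v i < len.+1)%N.
Proof.
by move=> il; rewrite ltnS (leq_trans (leq_div _ _)) // (leq_trans (occ_le _ _)).
Qed.

Lemma gam_const v s t : (s <= t)%N ->
  (forall r, (s <= r < t)%N -> ~~ flips r v) -> gam s v = gam t v.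
Proof.
elim: t => [|t IH]; first by rewrite leqn0 => /eqP->.
rewrite leq_eqVlt => /orP[/eqP-> //|]; rewrite ltnS => st nf.
rewrite IH // => [|r /andP[sr rt]]; last by apply: nf; rewrite sr ltnW.
by have := nf t; rewrite st ltnSn => /(_ isT); rewrite /flips negbK => /eqP.
Qed.

Variables (p : 'I_len -> 'I_n) (q : 'I_len -> option 'I_n).
Hypothesis flipsE : forall (i : 'I_len) v, flips i v = (v == p i) || (q i == Some v).
Hypothesis pq : forall i, q i != Some (p i).
(** [E_gap] keeps the end times of distinct moves apart. The sign conditions fix each flipped node
    relative to [sigma] before the move, which orients the move from [p i] to [q i]. *)
Variables (E : {set 'I_len}) (sigma : config n).
Hypothesis E_gap : forall i j : 'I_len, i \in E -> j \in E -> j != i.+1 :> nat.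
Hypothesis E_signp : forall i, i \in E -> gam i (p i) = sigma (p i).
Hypothesis E_signq : forall i v, i \in E -> q i = Some v -> gam i v = ~~ sigma v.
Hypothesis E_low : forall i, i \in E -> [exists v in low, flips i v].

Notation V := (option ('I_n * 'I_len.+1)).
(* A move is an edge between the chunks of the (at most two) nodes it flips;
   [None] replaces the missing endpoint of a single flip. *)
Definition vtx (v : 'I_n) (i : 'I_len) : 'I_n * 'I_len.+1 := (v, inord (chunk v i)).
Definition vs (i : 'I_len) : V := Some (vtx (p i) i).
Definition vd (i : 'I_len) : V := omap (fun v => vtx v i) (q i).

Lemma vtxE v (i : 'I_len) k : (vtx v i == (v, k)) = (chunk v i == k).
Proof.
have h := chunk_lt v (ltnW (ltn_ord i)).
by rewrite /vtx xpair_eqE eqxx /= -val_eqE /= inordK.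
Qed.

Lemma vsdE i v k : (vs i == Some (v, k)) = (p i == v) && (chunk v i == k).
Proof.
rewrite /vs (inj_eq Some_inj).
have [<-|pv] := eqVneq (p i) v; first by rewrite vtxE.
by rewrite /vtx xpair_eqE (negPf pv).
Qed.

Lemma vddE i v k : (vd i == Some (v, k)) = (q i == Some v) && (chunk v i == k).
Proof.
rewrite /vd; case: (q i) => [u|] //=; rewrite !(inj_eq Some_inj).
have [->|pv] := eqVneq u v; first by rewrite vtxE.
by rewrite /vtx xpair_eqE (negPf pv).
Qed.

Lemma vs_vd i : vs i != vd i.
Proof.
rewrite /vs /vd; have := pq i; case: (q i) => [v|] //=.
rewrite !(inj_eq Some_inj) /vtx xpair_eqE eq_sym; by move=> /negPf->.
Qed.

Lemma flip_sign (R : comPzRingType) i u : i \in E ->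
  (-1) ^+ gam i.+1 u - (-1) ^+ gam i u =
  (-1) ^+ sigma u * 2%:R * ((q i == Some u)%:R - (p i == u)%:R) :> R.
Proof.
move=> iE; have := flipsE i u; rewrite /flips [u == p i]eq_sym.
have [<- | pu] := eqVneq (p i) u.
  rewrite (negPf (pq i)) (E_signp iE) /=.
  by case: (sigma _); case: (gam _ _) => //= _; ring.
have [qu|qu] := eqVneq (q i) (Some u) => /=.
  rewrite (E_signq iE qu).
  by case: (sigma _); case: (gam _ _) => //= _; ring.
by move/negbFE/eqP->; ring.
Qed.

(** By the orientation, the sign of [u] jumps by the same amount, with opposite signs, when a move
    enters or leaves a chunk of [u]. Hence circulations annihilate the Walsh functions of degree
    one. *)
Lemma node_flow (R : comPzRingType) (x : 'I_len -> R) u :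
  (forall i, i \notin E -> x i = 0) ->
  \sum_i x i * ((-1) ^+ gam i.+1 u - (-1) ^+ gam i u) =
  (-1) ^+ sigma u * 2%:R * \sum_k boundary vs vd x (Some (u, k)).
Proof.
move=> xE; rewrite /boundary exchange_big mulr_sumr; apply: eq_bigr => i _ /=.
have [iE|/xE->] := boolP (i \in E); last first.
  by rewrite mul0r big1 ?mulr0 // => k _; rewrite mul0r.
rewrite flip_sign // -mulr_sumr sumrB.
have h (b : bool) : \sum_(k < len.+1) (b && (chunk u i == k))%:R = b%:R :> R.
  have lt := chunk_lt u (ltnW (ltn_ord i)).
  rewrite (bigD1 (Ordinal lt)) //= eqxx andbT big1 ?addr0 // => k.
  by rewrite -val_eqE /= eq_sym => /negPf->; rewrite andbF.
under eq_bigr do rewrite vddE; rewrite h.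
under eq_bigr do rewrite vsdE; rewrite h; ring.
Qed.

Definition signed_cycle (c : 'I_len -> int) :=
  [/\ forall i, `|c i| <= 1, exists i, c i != 0, circulation vs vd c &
      forall i, c i != 0 -> i \in E].

Definition pairing (c : 'I_len -> int) (f : config n -> int) : int :=
  \sum_i c i * (f (gam i.+1) - f (gam i)).

Lemma pairingD c f g : pairing c (fun x => f x + g x) = pairing c f + pairing c g.
Proof. by rewrite /pairing -big_split; apply: eq_bigr => i _ /=; ring. Qed.

Lemma pairingZ c k f : pairing c (fun x => k * f x) = k * pairing c f.
Proof. by rewrite /pairing mulr_sumr; apply: eq_bigr => i _ /=; ring. Qed.

Lemma eq_pairing c f g : f =1 g -> pairing c f = pairing c g.
Proof. by move=> fg; apply: eq_bigr => i _; rewrite !fg. Qed.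

Definition supp (c : 'I_len -> int) := [set i | c i != 0].

Lemma signed_cycle_node c u : signed_cycle c -> pairing c (fun g => (-1) ^+ g u) = 0.
Proof.
case=> _ _ circ cE; rewrite /pairing node_flow; last first.
  by move=> i; apply: contraNeq => /cE.
by rewrite big1 ?mulr0 // => k _; rewrite circ.
Qed.

(** * Shortening a signed cycle whose low moments all vanish *)

Section Reduction.
Variable c : 'I_len -> int.
Hypothesis c_cycle : signed_cycle c.
Hypothesis c_null : forall J, (#|J :\: low| <= 1)%N -> pairing c (walsh J) = 0.

(** A pair [(i, b)] stands for the configuration before or after the move [i], and [al] is its
    coefficient in [pairing c]; [cls] forgets the nodes outside [low] by setting them to [false]. *)
Let X : {set 'I_len * bool} := setX (supp c) setT.
Let pt (x : 'I_len * bool) := gam (x.1 + x.2)%N.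
Let al (x : 'I_len * bool) : int := c x.1 * (-1) ^+ (~~ x.2).
Let cls (x : 'I_len * bool) : config n := [ffun v => (v \in low) && pt x v].
Let fib x0 := [set x in X | cls x == cls x0].

Local Lemma suppE i : i \in supp c -> i \in E.
Proof. by case: c_cycle => _ _ _ cE; rewrite inE => /cE. Qed.

Local Lemma pt_inj : {in X &, injective pt}.
Proof.
move=> [i a] [j b]; rewrite /pt !inE /= !andbT => ci cj /gam_inj.
have [iE jE] : i \in E /\ j \in E by split; apply: suppE; rewrite inE.
have gij := E_gap iE jE; have gji := E_gap jE iE.
have li := ltn_ord i; have lj := ltn_ord j.
have -> : (i + a <= len)%N by case: a; lia.
have -> : (j + b <= len)%N by case: b; lia.
move=> /(_ isT isT) h.
have [ij ab] : i = j :> nat /\ a = b.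
  by move: h gij gji; case: (a); case: (b) => /=; lia.
by rewrite ab (val_inj ij).
Qed.

Local Lemma al_unit x : x \in X -> al x = 1 \/ al x = -1.
Proof.
case: c_cycle => c1 _ _ _.
case: x => i b; rewrite !inE andbT /al /= => ci; have := c1 i; move: ci.
by case: b => /=; rewrite ?expr0 ?expr1; lia.
Qed.

Local Lemma pairingE f : pairing c f = \sum_(x in X) al x * f (pt x).
Proof.
rewrite /pairing (bigID (mem (supp c))) /= [X in _ + X]big1 ?addr0; last first.
  by move=> i; rewrite inE negbK => /eqP->; rewrite mul0r.
transitivity (\sum_(i in supp c) \sum_(b : bool) al (i, b) * f (pt (i, b))).
  by apply: eq_bigr => i _; rewrite big_bool /al /pt /= addn1 addn0 expr0 expr1; ring.
rewrite pair_big_dep /=; apply: eq_big => [[i b]|[i b] _] //=.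
by rewrite !inE andbT.
Qed.

(** Multiplying out, each factor either keeps [J] or toggles a node of [low] in it; the nodes
    outside [low] never change, so [c_null] covers every term. *)
Local Lemma null_prod (s : seq 'I_n) (y : config n) J :
  {subset s <= low} -> (#|J :\: low| <= 1)%N ->
  pairing c (fun g => \prod_(u <- s) (1 + (-1) ^+ y u * (-1) ^+ g u) * walsh J g) = 0.
Proof.
elim: s J => [|u s IH] J sl Jl.
  by rewrite (@eq_pairing c _ (walsh J)) ?c_null // => g; rewrite big_nil mul1r.
have ul : u \in low by apply: sl; rewrite mem_head.
have sl' : {subset s <= low} by move=> v vs; apply: sl; rewrite inE vs orbT.
rewrite (@eq_pairing c _ (fun g =>
  \prod_(u <- s) (1 + (-1) ^+ y u * (-1) ^+ g u) * walsh J g +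
  (-1) ^+ y u * (\prod_(u <- s) (1 + (-1) ^+ y u * (-1) ^+ g u) *
    walsh (symd [set u] J) g))); last first.
  by move=> g; rewrite big_cons -walshM walsh1; ring.
rewrite pairingD pairingZ !IH ?mulr0 ?addr0 //.
rewrite (leq_trans (subset_leq_card _) Jl) //.
apply/subsetP => v; rewrite !inE; case: eqP => [->|_]; last by case: (v \in J).
by move: ul; rewrite inE => ->.
Qed.

(** Taken over all nodes of [low], the product of [null_prod] is a power of two times the indicator
    of the class of [x0], so [c_null] localises to each class. *)
Local Lemma null_fib x0 J : (#|J :\: low| <= 1)%N ->
  \sum_(x in fib x0) al x * walsh J (pt x) = 0.
Proof.
move=> Jl.
have := @null_prod (enum low) (pt x0) J.
have sl : {subset enum low <= low} by move=> v; rewrite mem_enum.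
move=> /(_ sl Jl); rewrite pairingE.
under eq_bigr do rewrite prod_sign_agree.
under eq_bigr => x _ do rewrite -[2 ^+ _ * _ * _]mulrA (mulrCA (al x)).
rewrite -mulr_sumr => /eqP; rewrite mulf_eq0 expf_eq0 /= andbF /= => /eqP h.
rewrite -[RHS]h [RHS](bigID (fun x => cls x == cls x0)) /= [X in _ + X]big1.
  rewrite addr0; apply: eq_big => [x|x]; first by rewrite inE.
  rewrite inE => /andP[_ /eqP cx].
  suff -> : all (fun u => pt x u == pt x0 u) (enum low) by rewrite mul1r.
  apply/allP => u; rewrite mem_enum => ul.
  by have := congr1 (fun g : config n => g u) cx; rewrite !ffunE ul /= => ->.
move=> x /andP[_ cx].
suff -> : all (fun u => pt x u == pt x0 u) (enum low) = false by rewrite mul0r mulr0.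
apply: contraNF cx => /allP h2; apply/eqP/ffunP => u; rewrite !ffunE.
by case: (boolP (u \in low)) => //= ul; apply/eqP/h2; rewrite mem_enum.
Qed.

(** Coefficients 1 and -1 with sum zero force an even size. With only two points, the degree-one
    identities would make them agree at every node, against [pt_inj]. *)
Local Lemma card_fib x0 : x0 \in X -> (4 <= #|fib x0|)%N.
Proof.
move=> x0X.
have fibX x : x \in fib x0 -> x \in X by rewrite inE => /andP[].
have x0f : x0 \in fib x0 by rewrite inE x0X /=.
have s0 : \sum_(x in fib x0) al x = 0.
  rewrite -[RHS](@null_fib x0 set0) ?set0D ?cards0 //.
  by apply: eq_bigr => x _; rewrite walsh0 mulr1.
have ev : ~~ odd #|fib x0|.
  have : \sum_(x in fib x0) al x =
      (#|fib x0|%:Z - 2 * \sum_(x in fib x0) (al x == -1)%:R :> int).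
    rewrite -sum1_card -natz natr_sum mulr_sumr -sumrB.
    by apply: eq_bigr => x /fibX /al_unit[->|->].
  rewrite s0 -natr_sum; lia.
have f0 : (0 < #|fib x0|)%N by rewrite card_gt0; apply/set0Pn; exists x0.
suff : #|fib x0| != 2%N by move: ev f0; move: #|fib x0| => [|[|[|[|?]]]].
apply/negP => /cards2P[x [x' [xx' fE]]].
have xX : x \in X by apply: fibX; rewrite fE !inE eqxx.
have x'X : x' \in X by apply: fibX; rewrite fE !inE eqxx orbT.
move: s0; rewrite fE big_setU1 ?inE //= big_set1 => s0.
apply: (negP xx'); apply/eqP/pt_inj => //; apply/ffunP => w.
have := @null_fib x0 [set w].
rewrite (leq_trans (subset_leq_card (subsetDl _ _))) ?cards1 // => /(_ isT).
rewrite fE big_setU1 ?inE //= big_set1 !walsh1.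
have -> : al x = - al x' by apply/eqP; rewrite -addr_eq0 s0.
case: (al_unit x'X) => ->; by case: (pt x w); case: (pt x' w).
Qed.

(** [None] counts as hot: conservation there, unlike at the chunks of nodes of [low], does not
    follow from the sign of a node. *)
Let hot (v : V) := if v is Some (u, _) then u \notin low else true.
Let inc (v : V) (i : 'I_len) := (vs i == v) || (vd i == v).
Let Hs := [set v | hot v & [exists i in supp c, inc v i]].
Let Y := cls @: X.

Local Lemma card_classes : (2 * #|Y| <= #|supp c|)%N.
Proof.
have : (\sum_(x in X) 1 = 2 * #|supp c|)%N.
  by rewrite sum1_card cardsX cardsT card_bool mulnC.
rewrite (partition_big_imset cls) /= => h.
suff : (#|Y| * 4 <= 2 * #|supp c|)%N by move: #|Y| #|supp c|; lia.
rewrite -sum_nat_const -h; apply: leq_sum => y /imsetP[x0 x0X ->].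
apply: leq_trans (card_fib x0X) _; rewrite sum1dep_card.
by apply: eq_leq; apply: eq_card => x; rewrite !inE.
Qed.

(** A move of [E] flips a node of [low], so at least one of its two endpoints is not hot. *)
Local Lemma hot_inc i v v' : i \in supp c -> hot v -> hot v' -> inc v i -> inc v' i -> v = v'.
Proof.
move=> iQ hv hv'.
have /existsP[u /andP[ul fu]] := E_low (suppE iQ).
have hp : p i \in low -> ~~ hot (vs i) by rewrite /hot /vs /vtx => ->.
have hq w : q i = Some w -> w \in low -> ~~ hot (vd i).
  by rewrite /hot /vd /vtx => -> /= ->.
rewrite /inc => /orP[/eqP e|/eqP e] /orP[/eqP e'|/eqP e'] //.
- by rewrite -e -e'.
- exfalso; move: fu; rewrite flipsE => /orP[/eqP up|/eqP qu].
    by move: hp; rewrite -up ul e hv => /(_ isT).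
  by move: (hq _ qu ul); rewrite e' hv'.
- exfalso; move: fu; rewrite flipsE => /orP[/eqP up|/eqP qu].
    by move: hp; rewrite -up ul e' hv' => /(_ isT).
  by move: (hq _ qu ul); rewrite e hv.
- by rewrite -e -e'.
Qed.

(** A move is never a loop, so a vertex with a single incident move of the cycle would violate
    conservation. *)
Local Lemma hot_degree v : v \in Hs -> (2 <= #|[set i in supp c | inc v i]|)%N.
Proof.
rewrite inE => /andP[_ /existsP[i /andP[iQ iv]]].
have i1 : i \in [set i in supp c | inc v i] by rewrite inE iQ.
have : (0 < #|[set i in supp c | inc v i]|)%N by rewrite card_gt0; apply/set0Pn; exists i.
rewrite leq_eqVlt => /orP[/eqP|//] /esym /eqP /cards1P[j jE].
have ij : i = j by apply/eqP; rewrite -in_set1 -jE.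
case: c_cycle => _ _ /(_ v) + _.
rewrite /boundary (bigD1 i) //= big1 ?addr0.
  move=> /eqP; rewrite mulf_eq0.
  have -> : (c i == 0) = false by apply/negbTE; move: iQ; rewrite inE.
  move: iv; rewrite /inc; have := vs_vd i.
  case: (eqVneq (vs i) v) => [->|] /=.
    by rewrite eq_sym => /negPf->.
  by move=> _ _ ->.
move=> k ki; have [->|ck] := eqVneq (c k) 0; first by rewrite mul0r.
have : k \notin [set i in supp c | inc v i] by rewrite jE inE -ij.
by rewrite !inE ck /= negb_or => /andP[/negPf-> /negPf->]; rewrite subrr mulr0.
Qed.

Local Lemma card_hot : (2 * #|Hs| <= #|supp c|)%N.
Proof.
have : (\sum_(v in Hs) 2 <= \sum_(v in Hs) \sum_(i in supp c) inc v i)%N.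
  apply: leq_sum => v /hot_degree; rewrite -sum1_card big_mkcond => h.
  rewrite (leq_trans h) // [leqRHS]big_mkcond leq_sum // => i _.
  by rewrite inE; case: (i \in supp c); case: (inc v i).
rewrite sum_nat_const mulnC => h; apply: leq_trans h _.
rewrite exchange_big -sum1_card; apply: leq_sum => i iQ /=.
rewrite -big_mkcondr /= sum1dep_card.
have [->|[v vH]] := set_0Vmem [set v | (v \in Hs) && inc v i]; first by rewrite cards0.
rewrite -(cards1 v); apply/subset_leq_card/subsetP => v'.
move: vH; rewrite !inE => /andP[/andP[hv _] iv] /andP[/andP[hv' _] iv'].
by apply/eqP; exact: hot_inc iv' iv.
Qed.

(* If all classes of configurations agreeing on [low] were balanced, each would
   contain at least four points of the cycle, so there are at most half as many
   classes as moves; the same holds for the vertices outside [low].  Conservation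
   at all but one of the classes and all but one of these vertices, together
   with the vanishing of one move, then leaves a nonzero solution. *)
Lemma signed_cycle_reduction : exists c', signed_cycle c' /\ (#|supp c'| < #|supp c|)%N.
Proof.
have [_ [i0 ci0] _ _] := c_cycle.
have i0Q : i0 \in supp c by rewrite inE.
pose y0 := cls (i0, true).
have y0Y : y0 \in Y by apply: imset_f; rewrite !inE ci0.
have [h0 h0P] : exists h0 : option V, if h0 is Some h then h \in Hs else Hs = set0.
  by have [->|[h hH]] := set_0Vmem Hs; [exists None|exists (Some h)].
pose H' := Hs :\: (if h0 is Some h then [set h] else set0).
pose W : finType := (config n + V + 'I_len)%type.
pose P : {set W} := ((fun y => inl (inl y)) @: (Y :\ y0)) :|:
  ((fun v => inl (inr v)) @: H') :|: [set inr i0].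
pose A (i : 'I_len) (w : W) : rat := match w with
  | inl (inl y) => (cls (i, true) == y)%:R - (cls (i, false) == y)%:R
  | inl (inr v) => (vd i == v)%:R - (vs i == v)%:R
  | inr j => (i == j)%:R end.
have PQ : (#|P| < #|supp c|)%N.
  have [l1 _] := leq_card_setU (((fun y => inl (inl y)) @: (Y :\ y0)) :|:
    ((fun v => inl (inr v)) @: H')) [set (inr i0 : W)].
  have [l2 _] := leq_card_setU ((fun y => inl (inl y) : W) @: (Y :\ y0))
    ((fun v => inl (inr v)) @: H').
  have l3 := leq_imset_card (fun y => inl (inl y) : W) (Y :\ y0).
  have l4 := leq_imset_card (fun y => inl (inr y) : W) H'.
  have := cardsD1 y0 Y; rewrite y0Y; have := card_classes; have := card_hot.
  have Q0 : (0 < #|supp c|)%N by rewrite card_gt0; apply/set0Pn; exists i0.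
  have hH : (#|H'| = 0 \/ #|Hs| = #|H'|.+1)%N.
    rewrite /H'; case: (h0) h0P => [h hH|->]; last by left; rewrite setD0 cards0.
    by right; rewrite (cardsD1 h) hH.
  have lP : (#|P| <= #|Y :\ y0| + #|H'| + 1)%N.
    by rewrite (leq_trans l1) // cards1 leq_add2r (leq_trans l2) // leq_add.
  move: lP hH Q0; move: #|P| #|Y| #|Hs| #|H'| #|Y :\ y0| #|supp c|.
  by move=> *; lia.
have [x [xn0 xQ xP]] := nontrivial_kernel A PQ.
have Qx i : x i != 0 -> i \in supp c by apply: contraNT => /xQ->.
have xE i : i \notin E -> x i = 0.
  by move=> iE; apply: xQ; apply: contraNN iE => /suppE.
have xi0 : x i0 = 0.
  have := xP (inr i0); rewrite !inE eqxx orbT => /(_ isT) /=.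
  rewrite (bigD1 i0) //= eqxx mulr1 big1 ?addr0 // => i /negPf->.
  by rewrite mulr0.
have clsP y : \sum_i x i * A i (inl (inl y)) = 0.
  have nY z : z \notin Y -> \sum_i x i * A i (inl (inl z)) = 0.
    move=> zY; rewrite big1 // => i _.
    have [->|/Qx iQ] := eqVneq (x i) 0; first by rewrite mul0r.
    have h b : cls (i, b) == z = false.
      by apply: contraNF zY => /eqP<-; apply: imset_f; rewrite in_setX iQ inE.
    by rewrite /= !h subrr mulr0.
  have nY0 z : z != y0 -> \sum_i x i * A i (inl (inl z)) = 0.
    move=> zy0; have [zY|/nY//] := boolP (z \in Y).
    apply: xP; rewrite !inE; apply/orP; left; apply/orP; left.
    by apply: imset_f; rewrite !inE zy0.
  have [->|/nY0//] := eqVneq y y0.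
  have := sum_boundary (fun i => cls (i, false)) (fun i => cls (i, true)) x.
  by rewrite (bigD1 y0) //= big1 ?addr0 // => z /nY0.
(* A node of [low] uses chunk 0 only and its sign is a function of the class, so conservation at the
   classes gives conservation at its vertex. *)
have lowP u k : u \in low -> boundary vs vd x (Some (u, k)) = 0.
  move=> ul.
  have other k' : k' != ord0 -> boundary vs vd x (Some (u, k')) = 0.
    move=> k0; rewrite /boundary big1 // => i _.
    rewrite vddE vsdE.
    have fl : flips i u -> (chunk u i == k') = false.
      by move=> fu; rewrite (chunk_low ul (ltn_ord i) fu) eq_sym; apply: negbTE.
    move: fl; rewrite flipsE [u == _]eq_sym.
    case: (p i == u); case: (q i == Some u) => //=; rewrite ?subrr ?mulr0 //.
      by move/(_ isT)->; rewrite subrr mulr0.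
    by move/(_ isT)->; rewrite subrr mulr0.
  have [->|/other//] := eqVneq k ord0.
  have := node_flow u xE; rewrite (bigD1 ord0) //= [X in _ * (_ + X)]big1 ?addr0; last first.
    by move=> k' /other.
  have -> : \sum_i x i * ((-1) ^+ gam i.+1 u - (-1) ^+ gam i u) =
      \sum_y (\sum_i x i * A i (inl (inl y))) * (-1) ^+ (y : config n) u.
    rewrite (sum_boundary_fun (fun i => cls (i, false)) (fun i => cls (i, true)) x
      (fun y : config n => (-1) ^+ y u)).
    by apply: eq_bigr => i _; rewrite !ffunE ul /pt /= addn1 addn0.
  rewrite big1 => [|y _]; last by rewrite clsP mul0r.
  by case: (sigma u); rewrite ?expr0 ?expr1; move/esym/eqP; rewrite ?mulN1r ?mulNr ?oppr_eq0 ?mul1r mulf_eq0 /= => /eqP.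
have nH v : v \notin Hs -> boundary vs vd x v = 0.
  rewrite inE negb_and => /orP[|nQ].
    by case: v => [[u k]|] //=; rewrite negbK => /lowP.
  rewrite /boundary big1 // => i _.
  have [->|/Qx iQ] := eqVneq (x i) 0; first by rewrite mul0r.
  have : ~~ inc v i.
    by apply: contraNN nQ => iv; apply/existsP; exists i; rewrite iQ.
  by rewrite negb_or => /andP[/negPf-> /negPf->]; rewrite subrr mulr0.
have nH' v : v \in H' -> boundary vs vd x v = 0.
  move=> vH; apply: (xP (inl (inr v))); rewrite !inE; apply/orP; left; apply/orP; right.
  exact: imset_f.
have xcirc : circulation vs vd x.
  move=> v; have [vH|/nH//] := boolP (v \in Hs).
  move: nH'; rewrite /H'; case: (h0) h0P => [h hH|H0]; last by rewrite H0 inE in vH.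
  move=> nH'.
  have nh z : z != h -> boundary vs vd x z = 0.
    move=> zh; have [zH|/nH//] := boolP (z \in Hs).
    by apply: nH'; rewrite !inE zh; move: zH; rewrite inE.
  have [->|/nh//] := eqVneq v h.
  have := sum_boundary vs vd x.
  by rewrite (bigD1 h) //= big1 ?addr0 // => z /nh.
have [c' [c1 c0 cc cx]] := unit_circulation xcirc xn0.
exists c'; split; first by split=> // i /cx /Qx /suppE.
apply: proper_card; apply/properP; split.
  by apply/subsetP => i; rewrite inE => /cx /Qx.
exists i0 => //; rewrite inE negbK; apply: contraT => /cx; by rewrite xi0 eqxx.
Qed.

End Reduction.
(** With more moves than vertices the incidence matrix has a nonzero rational kernel vector, and
    [unit_circulation] replaces it by coefficients in {-1, 0, 1}. *)
Lemma signed_cycle_exists (P : {set V}) :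
  (forall i, i \in E -> vs i \in P /\ vd i \in P) -> (#|P| < #|E|)%N ->
  exists c, signed_cycle c.
Proof.
move=> EP ltPE.
pose A i v : rat := (vd i == v)%:R - (vs i == v)%:R.
have [x [xn0 xE xP]] := nontrivial_kernel A ltPE.
have circ : circulation vs vd x.
  move=> v; have [vP|vP] := boolP (v \in P); first exact: xP.
  rewrite /boundary big1 // => i _.
  have [iE|/xE->] := boolP (i \in E); last by rewrite mul0r.
  have [sP dP] := EP i iE.
  have -> : vd i == v = false by apply: contraNF vP => /eqP<-.
  have -> : vs i == v = false by apply: contraNF vP => /eqP<-.
  by rewrite subrr mulr0.
have [c [c1 c0 cc cx]] := unit_circulation circ xn0.
exists c; split=> // i /cx; apply: contraNT => /xE->.
by rewrite eqxx.
Qed.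

(** Descent on the size of the support: as long as all these moments vanish, the reduction yields a
    shorter cycle. *)
Lemma signed_cycle_moment c : signed_cycle c -> exists c' J,
  [/\ signed_cycle c', (#|J :\: low| <= 1)%N & pairing c' (walsh J) != 0].
Proof.
have [m] := ubnP #|supp c|; elim: m c => // m IH c ltm cv.
have [/existsP[J /andP[Jl Jc]]|none] :=
  boolP [exists J : {set 'I_n}, (#|J :\: low| <= 1)%N && (pairing c (walsh J) != 0)].
  by exists c, J.
have [|c' [c'v lt]] := @signed_cycle_reduction c cv.
  move=> J Jl; apply/eqP; apply: contraNT none => Jc.
  by apply/existsP; exists J; rewrite Jl.
by apply: (IH c') => //; rewrite (leq_trans lt) // -ltnS.
Qed.

(** * Affine relations and their leading pairs *)

Definition moment (b : 'I_len.+1 -> int) J := \sum_t b t * walsh J (gam t).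

Definition affine_relation b := moment b set0 = 0 /\ forall v, moment b [set v] = 0.

(* Pairs have distinct weights, and a single node weighs less than any pair. *)
Definition weight (J : {set 'I_n}) := (\sum_(v in J) (2 ^ n + 2 ^ v))%N.

(** Minimality is asked only among pairs meeting [low]; the pairs to be collected all meet it, so
    this suffices for triangularity. *)
Definition leading_relation (e : {set 'I_n}) (b : 'I_len.+1 -> int) :=
  [/\ forall t, `|b t| <= 2, affine_relation b, moment b e != 0 &
      forall e' : {set 'I_n}, #|e'| = 2%N -> e' :&: low != set0 -> moment b e' != 0 ->
        (weight e <= weight e')%N].

(** Ties a pair to a move of [E]. The asymmetry matters: [u] will be a node of [low], so few moves
    can satisfy this condition for a given pair. *)
Definition touches (u w : 'I_n) := exists2 i : 'I_len, i \in E &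
  flips i u \/ flips i w /\ exists2 t : 'I_len, flips t u & chunk w t = chunk w i.

(** The coefficients of [c], read on times instead of moves and multiplied by a character; this
    translates all moments by [K]. *)
Definition twist (c : 'I_len -> int) K (t : 'I_len.+1) : int :=
  (\sum_i c i * ((t == i.+1 :> nat)%:R - (t == i :> nat)%:R)) * walsh K (gam t).

Lemma moment_twist c K J : moment (twist c K) J = pairing c (walsh (symd K J)).
Proof.
rewrite /moment /twist.
under eq_bigr do rewrite -mulrA walshM mulr_suml.
rewrite exchange_big /pairing; apply: eq_bigr => i _ /=.
have li := ltn_ord i.
have h (k : nat) (f : nat -> int) : (k < len.+1)%N ->
    \sum_(t < len.+1) (t == k :> nat)%:R * f t = f k.
  move=> kl; rewrite (bigD1 (Ordinal kl)) //= eqxx mul1r big1 ?addr0 // => t.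
  by rewrite -val_eqE /= => /negPf->; rewrite mul0r.
under eq_bigr do rewrite -mulrA mulrBl.
rewrite -mulr_sumr sumrB.
rewrite (h i.+1 (fun t => walsh (symd K J) (gam t))) //.
by rewrite (h i (fun t => walsh (symd K J) (gam t))) // ltnW.
Qed.

(** A time is the start of at most one move and the end of at most one. *)
Lemma normr_twist_le c K t : signed_cycle c -> `|twist c K t| <= 2.
Proof.
case=> c1 _ _ _; rewrite /twist normrM normr_walsh mulr1.
have h (k : 'I_len -> nat) : injective k -> \sum_i (t == k i :> nat)%:R <= 1 :> int.
  move=> kinj; rewrite -natr_sum natz lez_nat.
  rewrite (eq_bigr (fun i => if t == k i :> nat then 1 else 0)%N); last first.
    by move=> i _; case: eqP.
  rewrite -big_mkcond sum1dep_card.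
  apply/card_le1_eqP => i j; rewrite !inE => /eqP ti /eqP tj.
  by apply: kinj; rewrite -ti -tj.
have l1 : \sum_(i < len) (t == i.+1 :> nat)%:R <= 1 :> int.
  by apply: (h (fun i => i.+1)) => i j [/val_inj].
have l2 : \sum_(i < len) (t == i :> nat)%:R <= 1 :> int by apply: h; exact: val_inj.
apply: (@le_trans _ _ (1 + 1)) => //; apply: le_trans (lerD l1 l2).
rewrite -big_split; apply: le_trans (ler_norm_sum _ _ _) _.
apply: ler_sum => i _; rewrite normrM.
apply: le_trans (ler_wpM2r (normr_ge0 _) (c1 i)) _.
by rewrite mul1r; case: (_ == _); case: (_ == _).
Qed.
Lemma weight_symd (K e : {set 'I_n}) : (weight (symd K e) <= weight K + weight e)%N.
Proof.
rewrite /weight big_mkcond [X in (_ <= X + _)%N]big_mkcond.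
rewrite [X in (_ <= _ + X)%N]big_mkcond -big_split leq_sum // => v _; rewrite !inE.
by case: (v \in K); case: (v \in e) => /=; lia.
Qed.

Lemma weight_disj (K e : {set 'I_n}) : [disjoint K & e] -> weight (K :|: e) = (weight K + weight e)%N.
Proof. by move=> dis; rewrite /weight -bigU //; apply: eq_bigl => v; rewrite !inE. Qed.

Lemma weight1 v : (weight [set v] < 2 * 2 ^ n)%N.
Proof. by rewrite /weight big_set1 mul2n -addnn ltn_add2l ltn_exp2l. Qed.

Lemma weight2 (e : {set 'I_n}) : #|e| = 2%N -> (2 * 2 ^ n <= weight e)%N.
Proof. by move=> e2; rewrite /weight -{1}e2 -sum_nat_const leq_sum // => v _; rewrite leq_addr. Qed.

Lemma pairing_disjoint (c : 'I_len -> int) (J : {set 'I_n}) : (forall i v, c i != 0 -> v \in J -> ~~ flips i v) ->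
  pairing c (walsh J) = 0.
Proof.
move=> nf; rewrite /pairing big1 // => i _.
have [->|ci] := eqVneq (c i) 0; first by rewrite mul0r.
suff -> : walsh J (gam i.+1) = walsh J (gam i) by rewrite subrr mulr0.
by apply: eq_bigr => v vJ; have := nf i v ci vJ; rewrite /flips negbK => /eqP->.
Qed.

(** Otherwise no other node of [J] flips between two moves of the cycle in the same chunk of [w], so
    the Walsh function of [J :\ w] is constant on each chunk, and the pairing is a combination of
    the boundaries at the chunks of [w], all zero. *)
Lemma hot_touch (c : 'I_len -> int) (J : {set 'I_n}) w : signed_cycle c -> pairing c (walsh J) != 0 -> w \in J ->
  (forall (i : 'I_len) v, c i != 0 -> v \in J :\ w -> ~~ flips i v) ->
  exists2 u, u \in J :\ w & touches u w.
Proof.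
move=> cv Jc wJ nf; have [_ _ circ cE] := cv.
have [/existsP[i /and3P[ci fw /existsP[u /andP[uJ /existsP[t /andP[fu cw]]]]]]|none] :=
  boolP [exists i, [&& c i != 0, flips i w & [exists u in J :\ w,
    [exists t : 'I_len, flips t u && (chunk w t == chunk w i)]]]].
  exists u => //; exists i; first exact: cE.
  by right; split=> //; exists t => //; apply/eqP.
case/negP: Jc; apply/eqP.
set L := J :\ w.
have chiJ g : walsh J g = walsh L g * (-1) ^+ g w.
  by rewrite /walsh (big_setD1 w) //= mulrC.
have const (i j : 'I_len) : c i != 0 -> flips i w -> c j != 0 -> flips j w ->
    chunk w i = chunk w j -> walsh L (gam i) = walsh L (gam j).
  wlog ij : i j / (i <= j)%N.
    move=> H; have /orP[|] := leq_total i j; first exact: H.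
    by move=> ji ci fi cj fj e; apply/esym; apply: H.
  move=> ci fi cj fj e; apply: eq_bigr => u uL; congr (_ ^+ nat_of_bool _).
  apply: gam_const => // r /andP[ir rj]; apply: contraNN none => fr.
  apply/existsP; exists i; rewrite ci fi; apply/existsP; exists u; rewrite uL.
  have rl : (r < len)%N by apply: leq_trans rj (ltnW (ltn_ord j)).
  apply/existsP; exists (Ordinal rl); rewrite fr /= eqn_leq.
  by apply/andP; split; [rewrite e chunk_mono // ltnW|exact: chunk_mono].
(* The constant value on the chunk [k]; the default 0 is harmless, as it concerns chunks where the
   cycle never flips [w]. *)
pose lam (k : 'I_len.+1) : int :=
  if [pick i | [&& c i != 0, flips i w & chunk w i == k]] is Some i then walsh L (gam i) else 0.
have lamE (i : 'I_len) (k : 'I_len.+1) : c i != 0 -> flips i w -> chunk w i == k ->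
    lam k = walsh L (gam i).
  move=> ci fi /eqP ck; rewrite /lam; case: pickP => [j /and3P[cj fj /eqP kj]|/(_ i)].
    by apply: const => //; rewrite ck kj.
  by rewrite ci fi ck eqxx.
have term i : c i * (walsh J (gam i.+1) - walsh J (gam i)) =
    (-1) ^+ sigma w * 2%:R * \sum_k lam k * (c i *
      ((vd i == Some (w, k))%:R - (vs i == Some (w, k))%:R)).
  have [c0|ci] := eqVneq (c i) 0.
    by rewrite c0 mul0r big1 ?mulr0 // => k _; rewrite mul0r mulr0.
  have -> : walsh J (gam i.+1) - walsh J (gam i) =
      walsh L (gam i) * ((-1) ^+ gam i.+1 w - (-1) ^+ gam i w).
    rewrite !chiJ mulrBr; congr (_ * _ - _).
    apply: eq_bigr => v vL; have := nf i v ci vL.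
    by rewrite /flips negbK => /eqP->.
  rewrite (@flip_sign int) ?cE //.
  have lt := chunk_lt w (ltnW (ltn_ord i)).
  rewrite (bigD1 (Ordinal lt)) //= big1 ?addr0 => [|k].
    rewrite vddE vsdE /= eqxx !andbT.
    have := flipsE i w; rewrite [w == _]eq_sym.
    case: (boolP (flips i w)) => [fi _|_ /esym/norP[/negPf-> /negPf->]].
      rewrite (lamE i) //=; ring.
    by rewrite subrr !mulr0.
  by rewrite -val_eqE /= eq_sym vddE vsdE => /negPf->; rewrite !andbF subrr !mulr0.
rewrite /pairing (eq_bigr _ (fun i _ => term i)) -mulr_sumr exchange_big /=.
by rewrite big1 ?mulr0 // => k _; rewrite -mulr_sumr -/(boundary vs vd c _) circ mulr0.
Qed.

(* A Walsh function [J] of least weight not annihilated by the cycle is split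
   as [K] times a pair [e].  Multiplying the cycle by [walsh K] gives an affine
   relation, by minimality, whose nonzero pair moments all weigh at least as
   much as [e]: this is what makes the final linear forms triangular. *)
Lemma leading_exists c0 : signed_cycle c0 ->
  exists (e : {set 'I_n}) (b : 'I_len.+1 -> int) u w,
    [/\ e = [set u; w], u != w, u \in low, leading_relation e b & touches u w].
Proof.
move=> /signed_cycle_moment[c [J0 [cv J0l J0c]]].
pose good J := (#|J :\: low| <= 1)%N && (pairing c (walsh J) != 0).
have gJ0 : good J0 by rewrite /good J0l.
case: (arg_minnP weight gJ0) => J /andP[Jl Jc] Jmin.
have small K : (#|K :\: low| <= 1)%N -> (weight K < weight J)%N -> pairing c (walsh K) = 0.
  move=> Kl; rewrite ltnNge => /negP nw; apply/eqP; apply: contraT => Kc.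
  by case: nw; apply: Jmin; rewrite /good Kl.
have [_ _ _ cE] := cv.
suff [u [w [uJ wJ [uw ul /subsetP Kl tch]]]] : exists u w, [/\ u \in J, w \in J &
    [/\ u != w, u \in low, J :\: [set u; w] \subset low & touches u w]].
  exists [set u; w], (twist c (J :\: [set u; w])), u, w; split=> //.
  set e := [set u; w]; set K := J :\: e.
  have e2 : #|e| = 2%N by rewrite cards2 uw.
  have eJ : e \subset J by apply/subsetP => v /set2P[->|->].
  have dKe : [disjoint K & e] by rewrite -setI_eq0 /K setDE -setIA (setIC (~: e)) setICr setI0.
  have JE : J = K :|: e by rewrite setUC -{1}(setID J e) (setIidPr eJ).
  have wJE : weight J = (weight K + weight e)%N by rewrite JE weight_disj.
  have we := weight2 e2.
  (* [K] lies in [low], so multiplying by [walsh K] adds no node outside [low]. *)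
  have Knl (A : {set 'I_n}) : (#|A :\: low| <= 1)%N -> (#|symd K A :\: low| <= 1)%N.
    move=> Al; apply: leq_trans Al; apply/subset_leq_card/subsetP => v.
    rewrite !in_setD => /andP[vl]; rewrite vl /symd in_setU !in_setD.
    case/orP=> [/andP[_ vK]|/andP[]//].
    by case/negP: vl; apply: Kl; rewrite in_setD.
  split.
  - by move=> t; exact: normr_twist_le.
  - split=> [|v]; rewrite moment_twist; apply: small.
    + by apply: Knl; rewrite set0D cards0.
    + apply: leq_ltn_trans (weight_symd _ _) _.
      rewrite wJE ltn_add2l {1}/weight big_set0.
      by apply: leq_trans we; rewrite muln_gt0 expn_gt0.
    + by apply: Knl; rewrite (leq_trans (subset_leq_card (subsetDl _ _))) ?cards1.
    + apply: leq_ltn_trans (weight_symd _ _) _.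
      by rewrite wJE ltn_add2l; apply: leq_trans (weight1 v) we.
  - rewrite moment_twist; have -> : symd K e = J; last by [].
    by rewrite JE; apply/setP => v; rewrite !inE; case: (v == u); case: (v == w); case: (v \in J).
  move=> e' e'2 e'l; rewrite moment_twist => mn.
  have gs : good (symd K e').
    rewrite /good mn andbT; apply: Knl.
    rewrite -ltnS -[X in (_ < X)%N]e'2 -(cardsID low e') -[ltnLHS]add0n ltn_add2r.
    by rewrite card_gt0.
  have := leq_trans (Jmin _ gs) (weight_symd _ _).
  by rewrite wJE leq_add2l.
have other v : v \in J -> exists2 w, w \in J & w != v.
  move=> vJ; have : (1 < #|J|)%N.
    rewrite ltnNge; apply/negP => J1.
    have JE : J = [set v].
      by apply/esym/eqP; rewrite eqEcard sub1set vJ cards1.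
    case/negP: Jc; rewrite JE; apply/eqP; rewrite -[RHS](signed_cycle_node v cv).
    by apply: eq_pairing => g; rewrite walsh1.
  rewrite (cardsD1 v) vJ ltnS card_gt0 => /set0Pn[w].
  by rewrite !inE => /andP[wv wJ]; exists w.
(* If the cycle flips a node of [J] in [low], that node is [u], and [w] is the node of [J] outside
   [low] when there is one. Otherwise the cycle flips in [J] only the node outside [low], and
   [hot_touch] supplies [u]. *)
have [/existsP[u /and3P[uJ ul /existsP[i /andP[ci fi]]]]|none] :=
  boolP [exists u in J, (u \in low) && [exists i, (c i != 0) && flips i u]].
  have tch w : touches u w by exists i; [exact: cE|left].
  have [/eqP Jsub|/set0Pn[w wJl]] := boolP (J :\: low == set0).
    have [w wJ wu] := other u uJ.
    exists u, w; split=> //; split=> //; first by rewrite eq_sym.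
    by rewrite (subset_trans (subsetDl _ _)) // -setD_eq0 Jsub.
  move: (wJl); rewrite in_setD => /andP[wl wJ].
  exists u, w; split=> //; split=> //; first by apply: contraNneq wl => <-.
  apply/subsetP => v; rewrite in_setD in_set2 negb_or => /andP[/andP[_ vw] vJ].
  apply: contraT => vl; case/negP: vw; apply/eqP.
  by apply: (card_le1_eqP Jl w v wJl); rewrite in_setD vJ vl.
have nlow i v : c i != 0 -> v \in J -> flips i v -> v \notin low.
  move=> ci vJ fv; apply: contraNN none => vl.
  by apply/existsP; exists v; rewrite vJ vl; apply/existsP; exists i; rewrite ci.
have [/existsP[w /andP[wJ /existsP[i /andP[ci fi]]]]|nof] :=
  boolP [exists w in J, [exists i, (c i != 0) && flips i w]]; last first.
  case/negP: Jc; apply/eqP; apply: pairing_disjoint => i v ci vJ.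
  apply: contraNN nof => fv; apply/existsP; exists v; rewrite vJ.
  by apply/existsP; exists i; rewrite ci.
have wl := nlow i w ci wJ fi.
have inl v : v \in J -> v != w -> v \in low.
  move=> vJ vw; apply: contraT => vl; case/negP: vw; apply/eqP.
  have wA : w \in J :\: low by rewrite in_setD wl.
  by apply: (card_le1_eqP Jl w v wA); rewrite in_setD vl.
have [|u] := @hot_touch c J w cv Jc wJ.
  move=> j v cj; rewrite !inE => /andP[vw vJ]; apply/negP => fv.
  by have := nlow j v cj vJ fv; rewrite inl.
rewrite !inE => /andP[uw uJ] tch.
exists u, w; split=> //; split=> //; first exact: inl.
apply/subsetP => v; rewrite in_setD in_set2 negb_or => /andP[/andP[_ vw] vJ].
exact: inl.
Qed.
End Window.

(** * Counting leading pairs in a window *)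

(** Overwriting the values at [u] and [v] while remembering the two old ones is injective. *)
Lemma card_two_values n (u v : 'I_n) (a b : bool) : (u = v -> a = b) ->
  (#|{: config n}| <= 4 * #|[set s : config n | (s u == a) && (s v == b)]|)%N.
Proof.
move=> uv; set S := [set s | _].
pose f (s : config n) : config n * (bool * bool) :=
  ([ffun x => if x == u then a else if x == v then b else s x], (s u, s v)).
have finj : injective f.
  move=> s s' [/ffunP e eu ev]; apply/ffunP => x; have := e x; rewrite !ffunE.
  by case: eqP => [->//|_]; case: eqP => [->|].
rewrite -cardsT -(card_imset _ finj).
have -> : (4 * #|S| = #|setX S [set: bool * bool]|)%N.
  by rewrite cardsX cardsT card_prod !card_bool mulnC.
apply/subset_leq_card/subsetP => _ /imsetP[s _ ->]; rewrite !inE !ffunE !eqxx /=.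
by rewrite andbT; case: (eqVneq v u) => [vu|_]; rewrite ?eqxx // uv.
Qed.

Section WindowCount.
Variables (n len D : nat) (gam : nat -> config n).
Hypothesis D_gt0 : (0 < D)%N.
Hypothesis gam_inj : forall s t, (s <= len)%N -> (t <= len)%N -> gam s = gam t -> s = t.
Hypothesis gam_step : forall t, (t < len)%N -> (#|[set v | flips gam t v]| <= 2)%N.

Notation lowg := (low len D gam).
Notation flipsg := (flips gam).
Notation occg := (occ gam).
Notation chunkg := (chunk D gam).

Lemma endpoints (i : 'I_len) : exists pq : 'I_n * option 'I_n,
  (forall v, flipsg i v = (v == pq.1) || (pq.2 == Some v)) /\ pq.2 != Some pq.1.
Proof.
have li := ltn_ord i; have := gam_step li.
set S := [set v | flipsg i v] => S2.
have : S != set0.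
  apply: contraT; rewrite negbK => /eqP/setP S0.
  have : gam i = gam i.+1.
    by apply/ffunP => v; have := S0 v; rewrite !inE /flips => /negbFE/eqP.
  by move/gam_inj => /(_ (ltnW li) li)/n_Sn.
rewrite -card_gt0 => S0.
have [S1|S1] : #|S| = 1%N \/ #|S| = 2%N by move: #|S| S2 S0 => [|[|[|?]]] // _ _; [left|right].
- have/eqP/cards1P[u SE] := S1.
  exists (u, None); split=> // v /=.
  by have := in_set (fun v => flipsg i v) v; rewrite -/S SE !inE orbF.
- have/eqP/cards2P[u [w [uw SE]]] := S1.
  exists (u, Some w) => /=; split=> [v|].
    by have := in_set (fun v => flipsg i v) v; rewrite -/S SE !inE (inj_eq Some_inj) [w == v]eq_sym.
  by rewrite (inj_eq Some_inj) eq_sym.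
Qed.

Lemma card_flips u : #|[set i : 'I_len | flipsg i u]| = occg u len.
Proof. by rewrite /occ -sum1dep_card big_mkcond. Qed.

Lemma occ_ltn w (i j : nat) : flipsg i w -> (i < j)%N -> (occg w i < occg w j)%N.
Proof. by move=> fi ij; apply: leq_trans (occ_mono _ _ ij); rewrite occS fi addn1. Qed.

(** Flips of [w] in one chunk have distinct occurrence counts modulo [D]. *)
Lemma card_chunk w k : (#|[set i : 'I_len | flipsg i w & chunkg w i == k]| <= D)%N.
Proof.
have lt i : (occg w i %% D < D)%N by rewrite ltn_mod.
rewrite -[leqRHS]card_ord -(@card_in_imset _ _ (fun i : 'I_len => Ordinal (lt i))).
  exact: max_card.
move=> i j; rewrite !inE => /andP[fi /eqP ki] /andP[fj /eqP kj] [] e.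
have eo : occg w i = occg w j.
  by rewrite (divn_eq (occg w i) D) (divn_eq (occg w j) D) e; congr (_ * _ + _)%N; rewrite -/(chunkg w i) ki -kj.
apply: val_inj; case: (ltngtP i j) => //= ij.
  by have := occ_ltn fi ij; rewrite eo ltnn.
by have := occ_ltn fj ij; rewrite eo ltnn.
Qed.

Definition touched (u w : 'I_n) := [set i : 'I_len |
  flipsg i u || flipsg i w && [exists t : 'I_len, flipsg t u && (chunkg w t == chunkg w i)]].

(** The node [u] flips at most [D] times, and each of these times lies in one chunk of [w], which
    contains at most [D] flips of [w]. *)
Lemma card_touched u w : u \in lowg -> (#|touched u w| <= 2 * D ^ 2)%N.
Proof.
rewrite inE => ul.
have -> : (2 * D ^ 2 = D ^ 2 + D * D)%N by rewrite mul2n addnn expnS expn1.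
have sub : touched u w \subset [set i : 'I_len | flipsg i u] :|:
    \bigcup_(t in [set t : 'I_len | flipsg t u])
      [set i : 'I_len | flipsg i w & chunkg w i == chunkg w t].
  apply/subsetP => i; rewrite !inE => /orP[->//|/andP[fi /existsP[t /andP[ft ct]]]].
  by apply/orP; right; apply/bigcupP; exists t; rewrite !inE // fi eq_sym.
apply: leq_trans (subset_leq_card sub) _; apply: leq_trans (leq_card_setU _ _).1 _.
apply: leq_add.
  by rewrite card_flips; apply: leq_trans ul _; rewrite -mulnn leq_pmulr.
have : (#|\bigcup_(t in [set t : 'I_len | flipsg t u])
      [set i : 'I_len | flipsg i w & chunkg w i == chunkg w t]| <=
      \sum_(t in [set t : 'I_len | flipsg t u]) D)%N.
  elim/big_ind2: _ => [|x A y B xA yB|t _]; first by rewrite cards0.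
    by apply: leq_trans (leq_card_setU _ _).1 _; exact: leq_add.
  exact: card_chunk.
by rewrite sum_nat_const card_flips => h; apply: leq_trans h _; rewrite leq_mul2r ul orbT.
Qed.

Definition leading_pairs : {set {set 'I_n}} :=
  [set e : {set 'I_n} | [&& #|e| == 2%N, e :&: lowg != set0 &
    `[< exists b, leading_relation D gam e (b : 'I_len.+1 -> int) >]]].

Definition touched_by (e : {set 'I_n}) :=
  \bigcup_(u in e) \bigcup_(w in e | (u != w) && (u \in lowg)) touched u w.

Lemma card_touched_by (e : {set 'I_n}) : #|e| = 2%N -> (#|touched_by e| <= 4 * D ^ 2)%N.
Proof.
move=> /eqP/cards2P[u [w [uw ->]]].
have h x y : x != y -> (#|\bigcup_(z in [set u; w] | (x != z) && (x \in lowg)) touched x z|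
    <= \sum_(z in [set u; w] | x != z) 2 * D ^ 2)%N.
  move=> _; case: (boolP (x \in lowg)) => xl; last first.
    by rewrite big_pred0 ?cards0 // => z; rewrite /= !andbF.
  rewrite (eq_bigl (fun z => (z \in [set u; w]) && (x != z))); last first.
    by move=> z; rewrite andbT.
  elim/big_ind2: _ => [|m A m' B mA mB|z _]; first by rewrite cards0.
    by apply: leq_trans (leq_card_setU _ _).1 _; exact: leq_add.
  exact: card_touched.
rewrite /touched_by big_setU1 ?in_set1 //= big_set1.
apply: leq_trans (leq_card_setU _ _).1 _.
apply: leq_trans (leq_add (h u w uw) (h w u _)) _; first by rewrite eq_sym.
rewrite !sum_nat_cond_const /=.
have c1 x : x \in [set u; w] -> #|[set z in [set u; w] | x != z]| = 1%N.
  move=> xe; have := cardsD1 x [set u; w]; rewrite xe cards2 uw add1n => -[->].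
  by apply: eq_card => z; rewrite !inE andbC eq_sym.
by rewrite !c1 ?inE ?eqxx ?orbT //; lia.
Qed.

Variable M : {set 'I_len}.
Hypothesis M_low : forall i, i \in M -> [exists v in lowg, flipsg i v].

(** Bounds the number of vertices: the chunk indices of a node run from 0 to [occ %/ D], and the
    outer successor stands for [None]. *)
Definition vertex_bound :=
  (\sum_(v in [set v | [exists i in M, flipsg i v]]) (occg v len %/ D).+1).+1.

(** Averaging over the parity of the time and over [sigma]: a move passes the parity test for one of
    two values and the sign tests for at least a quarter of all [sigma], hence the factor 8. *)
Lemma filtered_count : exists (p : 'I_len -> 'I_n) (q : 'I_len -> option 'I_n)
    (E : {set 'I_len}) (sigma : config n),
  [/\ [/\ forall (i : 'I_len) v, flipsg i v = (v == p i) || (q i == Some v),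
      forall i, q i != Some (p i), E \subset M & (#|M| <= 8 * #|E|)%N],
      forall i j : 'I_len, i \in E -> j \in E -> j != i.+1 :> nat,
      forall i, i \in E -> gam i (p i) = sigma (p i) &
      forall i v, i \in E -> q i = Some v -> gam i v = ~~ sigma v].
Proof.
have [pq pqP] := fin_all_exists endpoints.
pose p i := (pq i).1; pose q i := (pq i).2; exists p, q.
pose sel (a : bool) (s : config n) (i : 'I_len) := [&& odd i == a, gam i (p i) == s (p i) &
  if q i is Some v then gam i v == ~~ s v else true].
pose F a s := [set i in M | sel a s i].
suff [a [s Fas]] : exists a s, (#|M| <= 8 * #|F a s|)%N.
  exists (F a s), s; split; first split=> //.
  - by move=> i v; have [-> _] := pqP i.
  - by move=> i; have [] := pqP i.
  - by apply/subsetP => i; rewrite inE => /andP[].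
  - move=> i j; rewrite !inE => /andP[_ /andP[/eqP oi _]] /andP[_ /andP[/eqP oj _]].
    by apply/eqP => ji; move: oj; rewrite ji /= -oi; case: odd.
  - by move=> i; rewrite inE => /andP[_ /and3P[_ /eqP]].
  - by move=> i v; rewrite inE => /andP[_ /and3P[_ _ +]] qi; rewrite qi => /eqP.
apply/not_existsP => nF.
have lt a s : (8 * #|F a s| < #|M|)%N.
  by rewrite ltnNge; apply/negP => h; apply: (nF a); exists s.
have tot : (2 * #|{: config n}| * #|M| <= \sum_(a : bool) \sum_(s : config n) 8 * #|F a s|)%N.
  have -> : (\sum_(a : bool) \sum_(s : config n) 8 * #|F a s| =
      \sum_(i in M) 8 * (\sum_(a : bool) \sum_(s : config n) sel a s i))%N.
    under [RHS]eq_bigr do rewrite big_distrr.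
    rewrite [RHS]exchange_big; apply: eq_bigr => a _ /=.
    under [RHS]eq_bigr do rewrite big_distrr.
    rewrite [RHS]exchange_big; apply: eq_bigr => s _ /=.
    rewrite -big_distrr /= -sum1dep_card big_mkcondr; congr (_ * _)%N.
  rewrite mulnC -sum_nat_const; apply: leq_sum => i _.
  have h : (#|{: config n}| <= 4 * \sum_(s : config n) sel (odd i) s i)%N.
    have /= pqi := (pqP i).2.
    case qi : (q i) => [v|].
      have := @card_two_values n (p i) v (gam i (p i)) (~~ gam i v).
      move=> /(_ _)/leq_trans; apply.
        by move=> pv; move: pqi; rewrite -/(q i) qi -/(p i) pv eqxx.
      rewrite leq_mul2l /= -sum1dep_card big_mkcond; apply/eq_leq/eq_bigr => s _.
      rewrite /sel qi eqxx /= [s (p i) == _]eq_sym; case: eqP => //= _.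
      by case: (s v); case: (gam i v).
    have := @card_two_values n (p i) (p i) (gam i (p i)) (gam i (p i)).
    move=> /(_ (fun=> erefl))/leq_trans; apply.
    rewrite leq_mul2l /= -sum1dep_card big_mkcond; apply/eq_leq/eq_bigr => s _.
    by rewrite /sel qi eqxx /= [s (p i) == _]eq_sym; case: eqP.
  rewrite -[8%N]/(2 * 4)%N -mulnA leq_mul2l /=; apply: leq_trans h _.
  by rewrite leq_mul2l /= big_bool; case: (odd i); rewrite ?leq_addl ?leq_addr.
have : (\sum_(a : bool) \sum_(s : config n) 8 * #|F a s| <
        \sum_(a : bool) \sum_(s : config n) #|M|)%N.
  have c0 : (0 < #|{: config n}|)%N by apply/card_gt0P; exists [ffun=> true].
  rewrite !big_bool /= -addSn leq_add //.
    rewrite [ltnRHS](bigD1 [ffun=> true]) //= [ltnLHS](bigD1 [ffun=> true]) //= -addSn.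
    by rewrite leq_add // leq_sum // => s _; exact: ltnW.
  by rewrite leq_sum // => s _; exact: ltnW.
move=> /(leq_ltn_trans tot).
by rewrite big_bool /= sum_nat_const -mulnA mul2n -addnn ltnn.
Qed.

(** Delete the moves touched by leading pairs. If more moves than vertices survived, they would
    contain a signed cycle, whose leading pair touches a surviving move: a contradiction. *)
Lemma window_count : (#|M| <= 8 * (vertex_bound + 4 * D ^ 2 * #|leading_pairs|))%N.
Proof.
have [p [q [E [sigma [[flE pq EM ME] gap sp sq]]]]] := filtered_count.
apply: leq_trans ME _; rewrite leq_mul2l /=.
pose del := \bigcup_(e in leading_pairs) touched_by e.
have del_le : (#|del| <= 4 * D ^ 2 * #|leading_pairs|)%N.
  rewrite mulnC -sum_nat_const /del.
  elim/big_ind2: _ => [|x A y B xA yB|e]; first by rewrite cards0.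
    by apply: leq_trans (leq_card_setU _ _).1 _; exact: leq_add.
  by rewrite inE => /andP[/eqP e2 _]; exact: card_touched_by.
pose E' := E :\: del.
have EE' : (#|E| <= #|E'| + #|del|)%N.
  by rewrite -(cardsID del E) addnC leq_add2l subset_leq_card // subsetIr.
apply: leq_trans EE' _; apply: leq_add del_le; rewrite leqNgt; apply/negP => ltE.
pose N := [set v | [exists i in M, flipsg i v]].
pose pairs := [set vk : 'I_n * 'I_len.+1 | (vk.1 \in N) && (vk.2 <= occg vk.1 len %/ D)%N].
pose P : {set option ('I_n * 'I_len.+1)} := None |: [set Some vk | vk in pairs].
have P_le : (#|P| <= vertex_bound)%N.
  rewrite /P cardsU1 /vertex_bound -/N -(add1n (\sum_(v in N) _)%N); apply: leq_add; first by rewrite leq_b1.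
  rewrite card_imset; last exact: Some_inj.
  rewrite /pairs -sum1dep_card.
  rewrite -(pair_big_dep (mem N) (fun v (k : 'I_len.+1) => (k <= occg v len %/ D)%N)
    (fun _ _ => 1%N)) /=.
  apply: leq_sum => v _; rewrite sum1dep_card.
  rewrite -[leqRHS]card_ord -(@card_in_imset _ _ (fun k : 'I_len.+1 => inord k : 'I_(occg v len %/ D).+1)).
    exact: max_card.
  move=> k k'; rewrite !inE => kl kl' /(congr1 val) /=; rewrite !inordK // => e.
  exact: val_inj.
have E'E i : i \in E' -> i \in E by rewrite inE => /andP[].
have gap' (i j : 'I_len) : i \in E' -> j \in E' -> j != i.+1 :> nat.
  by move=> /E'E iE /E'E jE; exact: gap.
have sp' i : i \in E' -> gam i (p i) = sigma (p i) by move=> /E'E; exact: sp.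
have sq' i v : i \in E' -> q i = Some v -> gam i v = ~~ sigma v by move=> /E'E; exact: sq.
have EM' i : i \in E' -> i \in M by move=> /E'E; exact: (subsetP EM).
have lowg' i : i \in E' -> [exists v in lowg, flipsg i v] by move=> /EM'; exact: M_low.
have vtxP i v : i \in E' -> flipsg i v -> Some (vtx D gam v i) \in P.
  move=> iE fi; rewrite !inE /=; apply: imset_f; rewrite !inE /vtx /=.
  apply/andP; split; first by apply/existsP; exists i; rewrite EM'.
  have li := ltnW (ltn_ord i).
  by rewrite inordK ?chunk_lt // /chunk leq_div2r // occ_mono.
have EP i : i \in E' -> vs D gam p i \in P /\ vd D gam q i \in P.
  move=> iE; split; first by apply: vtxP => //; rewrite flE eqxx.
  rewrite /vd; case qi : (q i) => [v|] /=; last by rewrite !inE.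
  by apply: vtxP => //; rewrite flE qi eqxx orbT.
have [c0 cv] := signed_cycle_exists EP (leq_ltn_trans P_le ltE).
have [e [b [u [w [eE uw ul lead [i iE' tch]]]]]] :=
  leading_exists D_gt0 gam_inj flE pq gap' sp' sq' lowg' cv.
have el : e \in leading_pairs.
  rewrite inE {1}eE cards2 uw /=; apply/andP; split.
    by apply/set0Pn; exists u; rewrite in_setI ul eE set21.
  by apply/asboolP; exists b.
move: iE'; rewrite inE => /andP[/negP nd _]; apply: nd.
apply/bigcupP; exists e => //; apply/bigcupP; exists u; first by rewrite eE !inE eqxx.
apply/bigcupP; exists w; first by rewrite eE set22 uw ul.
rewrite inE; case: tch => [->//|[-> [t ft ct]]]; apply/orP; right.
by apply/existsP; exists t; rewrite ft ct eqxx.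
Qed.

End WindowCount.

(** * Choice of the scale *)

Lemma sum_blocks (a b : nat) (F : nat -> nat) :
  (\sum_(t < a * b) F t = \sum_(j < a) \sum_(t < b) F (j * b + t))%N.
Proof.
elim: a => [|a IH]; first by rewrite mul0n !big_ord0.
rewrite big_ord_recr /= -IH mulSn addnC big_split_ord /=.
by congr (_ + _)%N; apply: eq_bigr.
Qed.

Lemma pigeonhole_sum (I : finType) (F : I -> nat) (m : nat) : (0 < #|I|)%N ->
  (m * #|I| <= \sum_i F i)%N -> exists i, (m <= F i)%N.
Proof.
move=> I0 le; apply/not_existsP => h.
have lt i : (F i < m)%N by rewrite ltnNge; apply/negP => /(h i).
have/card_gt0P[i0 _] := I0.
have : (\sum_i F i < \sum_(i : I) m)%N.
  rewrite [ltnRHS](bigD1 i0) //= [ltnLHS](bigD1 i0) //= -addSn leq_add // leq_sum // => i _.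
  exact: ltnW.
by rewrite sum_nat_const mulnC ltnNge le.
Qed.

(** Number of moves per leading pair: one factor [K] is lost in choosing the scale, and [K ^ 2]
    because a pair touches up to [4 * D ^ 2] moves, with [D] proportional to [K]. *)
Definition scale_const (K : nat) := (2 ^ 27 * K ^ 3)%N.

Section Scales.
Variables (n K : nat) (gam : nat -> config n).
Hypothesis K_gt0 : (0 < K)%N.
Let D := (2 ^ 10 * K)%N.
Hypothesis nD : (2 * (n * D) <= 2 ^ K)%N.
Hypothesis gam_inj : forall s t, (s <= 2 ^ K)%N -> (t <= 2 ^ K)%N -> gam s = gam t -> s = t.
Hypothesis gam_step : forall t, (t < 2 ^ K)%N -> (#|[set v | flips gam t v]| <= 2)%N.

Notation flipsg := (flips gam).

Definition window (s t : nat) := gam (s + t)%N.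

Lemma flips_shift s t v : flips (window s) t v = flipsg (s + t) v.
Proof. by rewrite /flips /window addnS. Qed.

Definition cnt k t v := occ (window (t %/ 2 ^ k * 2 ^ k)) v (2 ^ k).

Lemma cntE k t v : (cnt k t v = \sum_(i < 2 ^ k) flipsg (t %/ 2 ^ k * 2 ^ k + i) v)%N.
Proof. by apply: eq_bigr => i _; rewrite flips_shift. Qed.

Let D_gt0 : (0 < D)%N. Proof. by rewrite muln_gt0 K_gt0 expn_gt0. Qed.

Lemma flips_neq0 t : (t < 2 ^ K)%N -> exists v, flipsg t v.
Proof.
move=> tl; apply/not_existsP => nf.
have : gam t = gam t.+1 by apply/ffunP => v; apply/eqP; apply: contra_notT (nf v).
by move/gam_inj => /(_ (ltnW tl) tl); lia.
Qed.

Lemma sum_flips t : (t < 2 ^ K)%N -> (\sum_v flipsg t v <= 2)%N.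
Proof. by move=> tl; have := gam_step tl; rewrite -sum1dep_card big_mkcond. Qed.

Lemma block_le k t : (t < 2 ^ K)%N -> (k <= K)%N ->
  (t %/ 2 ^ k * 2 ^ k + 2 ^ k <= 2 ^ K)%N.
Proof.
move=> tl kK; rewrite -mulSnr -(subnK kK) expnD leq_pmul2r ?expn_gt0 //.
by rewrite ltn_divLR ?expn_gt0 // -expnD subnK.
Qed.

Lemma sum_cnt k t : (t < 2 ^ K)%N -> (k <= K)%N -> (\sum_v cnt k t v <= 2 * 2 ^ k)%N.
Proof.
move=> tl kK; under eq_bigr do rewrite cntE.
rewrite exchange_big [leqRHS]mulnC -[X in (_ <= X * _)%N]card_ord -sum_nat_const.
apply: leq_sum => i _; apply: sum_flips; apply: leq_trans (block_le tl kK).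
by rewrite ltn_add2l.
Qed.

(* Some node of the move [t] is rare in the block of length [2 ^ k] around [t],
   but all of them are frequent in the block of length [2 ^ k.+1]. *)
Definition tight_scale k t := [forall v, flipsg t v ==> (D < cnt k.+1 t v)%N] &&
  [exists v, flipsg t v && (cnt k t v <= D)%N].

(** Take the predecessor of the least scale at which all flipped nodes are frequent; that scale is
    not 0, since a block of one move flips a node at most once. *)
Lemma tight_scale_exists t : (t < 2 ^ K)%N ->
  [forall v, flipsg t v ==> (D < cnt K t v)%N] -> exists k : 'I_K, tight_scale k t.
Proof.
move=> tl hK.
pose Q k := [forall v, flipsg t v ==> (D < cnt k t v)%N].
have exQ : exists k, Q k by exists K.
case: (ex_minnP exQ) => -[|k] /forallP Qk kmin.
  have [v fv] := flips_neq0 tl; have := Qk v; rewrite fv /= cntE expn0 big_ord1.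
  by rewrite divn1 muln1 addn0 fv; move: D_gt0; case: (D) => [|[|]].
have kK : (k < K)%N by apply: kmin.
exists (Ordinal kK); apply/andP; split; first by apply/forallP.
have : ~~ Q k by apply/negP => /kmin; rewrite ltnn.
rewrite negb_forall => /existsP[v]; rewrite negb_imply -leqNgt => h.
by apply/existsP; exists v.
Qed.

(** A move without tight scale flips a node occurring at most [D] times in the whole run; there are
    at most [n * D] such moves, hence at most half of all. *)
Lemma tight_scale_count : (2 ^ K <= 2 * \sum_(k < K) \sum_(t < 2 ^ K) tight_scale k t)%N.
Proof.
pose bad t := ~~ [forall v, flipsg t v ==> (D < cnt K t v)%N].
have badS : (\sum_(t < 2 ^ K) bad t <= n * D)%N.
  pose tot v := (\sum_(t < 2 ^ K) flipsg t v)%N.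
  have cK (t : 'I_(2 ^ K)) v : cnt K t v = tot v.
    by rewrite cntE divn_small // mul0n.
  apply: (@leq_trans (\sum_(t < 2 ^ K) \sum_(v | (tot v <= D)%N) flipsg t v)).
    apply: leq_sum => t _; rewrite /bad; case: (boolP [forall _, _]) => // /forallPn[v].
    rewrite negb_imply -leqNgt cK => /andP[fv vD].
    by rewrite (bigD1 v) //= fv.
  rewrite exchange_big /=; apply: (@leq_trans (\sum_(v < n) D)); last first.
    by rewrite sum_nat_const card_ord.
  by rewrite [leqRHS](bigID (fun v => tot v <= D)%N) /= (leq_trans _ (leq_addr _ _)) // leq_sum.
have : (2 ^ K <= \sum_(t < 2 ^ K) bad t + \sum_(k < K) \sum_(t < 2 ^ K) tight_scale k t)%N.
  rewrite exchange_big -big_split /= -[leqLHS]card_ord -sum1_card leq_sum // => t _.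
  have [|/negbNE h] := boolP (bad t) => //.
  by have [k gk] := tight_scale_exists (ltn_ord t) h; rewrite (bigD1 k) //= gk.
by move=> h; have := leq_trans badS (leqnn _); move: h nD; set A := (\sum_(t < _) bad t)%N;
  set B := (\sum_(k < K) _)%N; move: A B (2 ^ K)%N (n * D)%N => A B x y; lia.
Qed.

(** Pigeonhole over the [K] scales, then over the dyadic blocks of the chosen scale. *)
Lemma tight_scale_block : exists (k : 'I_K) (j : 'I_(2 ^ (K - k))),
  (2 ^ k <= 2 * K * \sum_(t < 2 ^ k) tight_scale k (j * 2 ^ k + t))%N.
Proof.
have [||k hk] := @pigeonhole_sum 'I_K
    (fun k => 2 * K * \sum_(t < 2 ^ K) tight_scale k t)%N (2 ^ K).
- by rewrite card_ord.
- rewrite card_ord -big_distrr /= mulnC -mulnA (mulnCA 2) leq_mul2l.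
  by rewrite tight_scale_count orbT.
have kK : (2 ^ K = 2 ^ (K - k) * 2 ^ k)%N by rewrite -expnD subnK // ltnW.
have [||j hj] := @pigeonhole_sum 'I_(2 ^ (K - k))
    (fun j => 2 * K * \sum_(t < 2 ^ k) tight_scale k (j * 2 ^ k + t))%N (2 ^ k).
- by rewrite card_ord expn_gt0.
- rewrite card_ord -big_distrr /= -(sum_blocks _ _ (fun t => tight_scale k t)) -kK.
  by rewrite mulnC -kK.
by exists k, j.
Qed.

(** The chosen block has at least [2 ^ k / (2 * K)] tight moves but only about [6 * 2 ^ k / D]
    vertices. The factor [2 ^ 10] in [D] makes the latter negligible, so the leading pairs must
    account for the moves. *)
Lemma leading_window : exists k s, [/\ (k < K)%N, (s + 2 ^ k <= 2 ^ K)%N &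
  (2 ^ k <= scale_const K * #|leading_pairs (2 ^ k) D (window s)|)%N].
Proof.
have [k [j hM]] := tight_scale_block.
set s := (j * 2 ^ k)%N in hM.
have kK : (k < K)%N by [].
have sK : (s + 2 ^ k <= 2 ^ K)%N.
  have -> : (2 ^ K = 2 ^ (K - k) * 2 ^ k)%N by rewrite -expnD subnK // ltnW.
  by rewrite /s -mulSnr leq_mul2r ltn_ord orbT.
exists k, s; split=> //.
have st (t : 'I_(2 ^ k)) : (s + t < 2 ^ K)%N.
  by apply: leq_trans sK; rewrite ltn_add2l.
have sdiv (t : 'I_(2 ^ k)) : ((s + t) %/ 2 ^ k * 2 ^ k = s)%N.
  by rewrite /s divnMDl ?expn_gt0 // (divn_small (ltn_ord t)) addn0.
pose M : {set 'I_(2 ^ k)} := [set t : 'I_(2 ^ k) | tight_scale k (s + t)].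
have cM : #|M| = (\sum_(t < 2 ^ k) tight_scale k (s + t))%N.
  by rewrite -sum1dep_card big_mkcond.
have inj' a b : (a <= 2 ^ k)%N -> (b <= 2 ^ k)%N -> window s a = window s b -> a = b.
  move=> ak bk /gam_inj e; apply/eqP; rewrite -(eqn_add2l s); apply/eqP/e;
  by apply: leq_trans sK; rewrite leq_add2l.
have step' t : (t < 2 ^ k)%N -> (#|[set v | flips (window s) t v]| <= 2)%N.
  move=> tk; have := gam_step (st (Ordinal tk)) => /=; apply: leq_trans.
  by apply: eq_leq; apply: eq_card => v; rewrite !inE flips_shift.
have M_low (i : 'I_(2 ^ k)) : i \in M ->
    [exists v in low (2 ^ k) D (window s), flips (window s) i v].
  rewrite inE => /andP[_ /existsP[v /andP[fv cv]]]; apply/existsP; exists v.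
  by rewrite inE flips_shift fv andbT; move: cv; rewrite /cnt sdiv.
have := window_count D_gt0 inj' step' M_low.
set rho := #|leading_pairs _ _ _|; set vb := vertex_bound _ _ _ => wc.
have M0 : (0 < #|M|)%N.
  by move: hM; rewrite -cM; case: #|M| => //; rewrite muln0 leqn0 expn_eq0.
have/card_gt0P[t0 t0M] := M0.
pose c1 v := cnt k.+1 s v.
have s1 (t : 'I_(2 ^ k)) : ((s + t) %/ 2 ^ k.+1 = s %/ 2 ^ k.+1)%N.
  by rewrite expnSr !divnMA divnMDl ?expn_gt0 // (divn_small (ltn_ord t)) addn0 /s mulnK ?expn_gt0.
have s0K : (s < 2 ^ K)%N by apply: leq_trans sK; rewrite -[ltnLHS]addn0 ltn_add2l expn_gt0.
have hot v : [exists i in M, flips (window s) i v] -> (D < c1 v)%N.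
  case/existsP=> t /andP[]; rewrite inE => /andP[/forallP/(_ v) + _].
  by rewrite flips_shift => /implyP h /h; rewrite /cnt s1.
have c1S : (\sum_v c1 v <= 2 * 2 ^ k.+1)%N by apply: sum_cnt.
(* The full chunks of a node are paid by its flips in the block, and its extra chunk by its more
   than [D] flips in the double block. *)
have vbD : (D * vb <= D + 6 * 2 ^ k)%N.
  rewrite /vb /vertex_bound mulnS leq_add2l.
  set N := [set v | _].
  have -> : (6 * 2 ^ k = 2 * 2 ^ k + 2 * 2 ^ k.+1)%N by rewrite expnS; lia.
  have cnt0 v : occ (window s) v (2 ^ k) = cnt k s v.
    by rewrite /cnt /s mulnK ?expn_gt0.
  have k0S : (\sum_v cnt k s v <= 2 * 2 ^ k)%N by apply: sum_cnt => //; exact: ltnW.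
  apply: leq_trans (leq_add k0S c1S); rewrite -big_split big_distrr /=.
  rewrite big_mkcond leq_sum // => v _; rewrite inE.
  case: ifP => // /hot lt; rewrite mulnS addnC leq_add ?(ltnW lt) //.
  by rewrite -cnt0 mulnC leq_trunc_div.
have D2k : (D < 2 * 2 ^ k)%N.
  have [v fv] := flips_neq0 (st t0).
  have : (D < c1 v)%N.
    by apply: hot; apply/existsP; exists t0; rewrite t0M flips_shift.
  by move/leq_trans; apply; rewrite -expnS; exact: occ_le.
move: hM wc vbD D2k; rewrite -cM /scale_const.
have : (D = 2 ^ 10 * K)%N by [].
clearbody D; move: #|M| vb rho => m b r.
set x := (2 ^ k)%N => DE h1 h2 h3 h4.
have a1 : (D * x <= 16 * K * (8 * x + 4 * D ^ 3 * r))%N.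
  have : (D * x <= 2 * K * (8 * (D * b + 4 * D ^ 3 * r)))%N.
    apply: leq_trans (leq_mul (leqnn D) h1) _.
    rewrite mulnCA leq_mul2l; apply/orP; right.
    apply: leq_trans (leq_mul (leqnn D) h2) _.
    by rewrite mulnCA !mulnDr leq_add // expnS; nia.
  move/leq_trans; apply.
  have -> : (2 * K * (8 * (D * b + 4 * D ^ 3 * r)) = 16 * K * (D * b + 4 * D ^ 3 * r))%N by ring.
  by rewrite leq_mul2l leq_add2r; apply/orP; right; lia.
have c3 : (4 * (2 ^ 10) ^ 3 = 32 * 2 ^ 27)%N.
  by rewrite -[4%N]/(2 ^ 2)%N -[32%N]/(2 ^ 5)%N -expnM -!expnD; congr (2 ^ _)%N.
have c1024 : (2 ^ 10 = 1024)%N by rewrite -[10%N]/(5 + 5)%N expnD.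
move: DE c3 c1024; move: (2 ^ 10)%N (2 ^ 27)%N => c z DE c3 c1024.
have a2 : (c * x <= 16 * (8 * x + 4 * D ^ 3 * r))%N.
  rewrite -(leq_pmul2l K_gt0); move: a1; rewrite {1}DE.
  have -> : (c * K * x = K * (c * x))%N by ring.
  by have -> : (16 * K * (8 * x + 4 * D ^ 3 * r) = K * (16 * (8 * x + 4 * D ^ 3 * r)))%N by ring.
have a3 : (4 * D ^ 3 * r = 32 * z * (K ^ 3 * r))%N by rewrite DE -c3; ring.
move: a2; rewrite a3 c1024.
rewrite -!mulnA; move: (z * (K ^ 3 * r))%N => y; lia.
Qed.

End Scales.

(** * Triangular systems of linear forms *)

Section ProductWeight.
Variables (R : realFieldType) (F : finType) (m : nat).
Variables (pr : F -> 'I_m.+1 -> R) (eta : R).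
Hypothesis pr_ge0 : forall f k, 0 <= pr f k.
Hypothesis pr_le : forall f k, pr f k <= eta.
Hypothesis pr_sum : forall f, \sum_k pr f k <= 1.

(** Bound the factors in [E] by [eta] and group the remaining ones by the coordinates outside [E]: a
    group has at most [N ^ #|E|] members, and the total weight of the groups is at most 1. *)
Lemma product_weight (S : {set {ffun F -> 'I_m.+1}}) (E : {set F}) (N : nat) :
  (forall y : {ffun F -> 'I_m.+1},
     (#|[set z in S | [forall f, (f \notin E) ==> (z f == y f)]]%SET| <= N ^ #|E|)%N) ->
  \sum_(z in S) \prod_f pr f (z f) <= (N%:R * eta) ^+ #|E|.
Proof.
move=> cnt.
have eta_ge0 : F -> 0 <= eta by move=> f; apply: le_trans (pr_le f ord0).
have eta_pow : 0 <= eta ^+ #|E|.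
  have [->|[f _]] := set_0Vmem E; first by rewrite cards0.
  exact/exprn_ge0/eta_ge0.
(* A point mass at [ord0] on [E], so that each group is represented by the one function that is
   [ord0] on [E]. *)
pose G f k : R := if f \in E then (k == ord0)%:R else pr f k.
have G_ge0 f k : 0 <= G f k by rewrite /G; case: ifP.
pose base (z : {ffun F -> 'I_m.+1}) : {ffun F -> 'I_m.+1} := [ffun f => if f \in E then ord0 else z f].
have bound (z : {ffun F -> 'I_m.+1}) : \prod_f pr f (z f) <= eta ^+ #|E| * \prod_f G f (base z f).
  rewrite (bigID (mem E)) [X in _ <= _ * X](bigID (mem E)) /=.
  rewrite [X in _ <= _ * (X * _)]big1 ?mul1r; last first.
    by move=> f fE; rewrite /G ffunE fE eqxx.
  rewrite (_ : \prod_(f | f \notin E) G f (base z f) = \prod_(f | f \notin E) pr f (z f)); last first.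
    by apply: eq_bigr => f /negPf fE; rewrite /G ffunE fE.
  apply: ler_wpM2r; first exact: prodr_ge0.
  by rewrite -prodr_const; apply: ler_prod => f _; rewrite pr_ge0 pr_le.
apply: le_trans (ler_sum _ (fun z _ => bound z)) _.
rewrite -mulr_sumr exprMn mulrC; apply: ler_wpM2r => //.
rewrite (partition_big base xpredT) //=.
apply: (@le_trans _ _ (\sum_(y : {ffun F -> 'I_m.+1}) (N ^ #|E|)%N%:R * \prod_f G f (y f))).
  apply: ler_sum => y _.
  rewrite [X in X <= _](eq_bigr (fun=> \prod_f G f (y f))); last by move=> z /andP[_ /eqP<-].
  rewrite sumr_const -[_ *+ _]mulr_natl; apply: ler_wpM2r; first exact: prodr_ge0.
  rewrite ler_nat; apply: leq_trans (cnt y); apply/subset_leq_card/subsetP => z.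
  rewrite !inE => /andP[-> /eqP/ffunP by_] /=; apply/forallP => f; apply/implyP => /negPf fE.
  by have := by_ f; rewrite ffunE fE => ->.
rewrite -mulr_sumr natrX -[leRHS]mulr1; apply: ler_wpM2l; first exact: exprn_ge0.
rewrite -(bigA_distr_bigA G) /=; apply: prodr_ile1 => f _; apply/andP; split.
  exact: sumr_ge0.
rewrite /G; case: (f \in E) => //.
by rewrite (bigD1 ord0) //= big1 ?addr0 // => k /negPf->.
Qed.

End ProductWeight.

Section PivotCount.
Variables (F : finType) (m W : nat) (idx : 'I_m -> int).
Hypothesis idx_inj : injective idx.
Variables (E : {set F}) (V : F -> F -> int) (wt : F -> nat).
Hypothesis wt_inj : injective wt.
Hypothesis V_diag : forall e, e \in E -> V e e != 0.
Hypothesis V_tri : forall e e', e \in E -> e' \in E -> V e e' != 0 -> (wt e <= wt e')%N.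

(** Triangular elimination: the integer rows, each with [2 * W + 1] possible values, determine [z].
    If two solutions had the same rows, the row of the heaviest coordinate where they differ would
    see no other difference, and its diagonal entry is nonzero. *)
Lemma pivot_count (S : {set {ffun F -> 'I_m}}) (y : {ffun F -> 'I_m}) :
  (forall z, z \in S -> forall e, e \in E -> `|\sum_f V e f * idx (z f)| <= W%:Z) ->
  (#|[set z in S | [forall f, (f \notin E) ==> (z f == y f)]]%SET| <= (2 * W).+1 ^ #|E|)%N.
Proof.
move=> SW; set A := [set z in S | _]%SET.
pose row (z : {ffun F -> 'I_m}) e := \sum_f V e f * idx (z f).
pose g (z : {ffun F -> 'I_m}) : {ffun F -> 'I_(2 * W).+1} :=
  [ffun e => if e \in E then inord (absz (row z e + W%:Z)) else ord0].
have -> : ((2 * W).+1 ^ #|E| = #|pffun_on (ord0 : 'I_(2 * W).+1) (mem E) predT|)%N.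
  by rewrite card_pffun_on cardT size_enum_ord.
have ginj : {in A &, injective g}.
  move=> z z'; rewrite !inE => /andP[zS /forallP zy] /andP[z'S /forallP z'y] /ffunP gE.
  have rowE e : e \in E -> row z e = row z' e.
    move=> eE; have := gE e; rewrite !ffunE eE => /(congr1 val) /=.
    have := SW z zS e eE; have := SW z' z'S e eE; rewrite -!/(row _ _).
    move: (row z e) (row z' e) => a a' h' h; rewrite !inordK; lia.
  apply/eqP; apply: contraT => zz'.
  have [f0 f0P] : exists f, z f != z' f.
    apply/existsP; apply: contraNT zz' => /existsPn h; apply/eqP/ffunP => f.
    by apply/eqP; rewrite -[_ == _]negbK h.
  case: (@arg_maxnP _ f0 (fun f => z f != z' f) wt f0P) => e ne emax.
  have eE : e \in E.
    apply: contraNT ne => eE.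
    by have := zy e; have := z'y e; rewrite eE /= => /eqP-> /eqP->.
  have := rowE e eE; rewrite /row (bigD1 e) //= [RHS](bigD1 e) //=.
  rewrite (eq_bigr (fun f => V e f * idx (z' f))) => [/addIr|f fe].
    move/(mulfI (V_diag eE))/idx_inj => zz; by rewrite zz eqxx in ne.
  have [->//|nf] := eqVneq (z f) (z' f).
  have fE : f \in E.
    apply: contraNT nf => fE.
    by have := zy f; have := z'y f; rewrite fE /= => /eqP-> /eqP->.
  have [->|Vn] := eqVneq (V e f) 0; first by rewrite !mul0r.
  have := V_tri eE fE Vn; have := emax f nf => l1 l2.
  by case/negP: fe; apply/eqP/wt_inj/eqP; rewrite eqn_leq; apply/andP.
rewrite -(card_in_imset ginj); apply/subset_leq_card/subsetP => _ /imsetP[z _ ->].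
apply/pffun_onP; split; last by [].
by apply/subsetP => e; rewrite inE ffunE; case: (e \in E) => //; rewrite eqxx.
Qed.

End PivotCount.

From mathcomp Require Import all_classical all_reals all_analysis.
From mathcomp Require Import measurable_realfun.

Import numFieldNormedType.Exports.

(** * Coding windows *)

Section Transfer.
Variables (n len : nat) (gam gam' : nat -> config n).
Hypothesis agree : forall v,
  (forall t, (t <= len)%N -> gam t v = gam' t v) \/
  (forall t, (t <= len)%N -> gam t v = gam 0 v /\ gam' t v = gam' 0 v).
Variable b : 'I_len.+1 -> int.
Hypothesis b_rel : affine_relation gam b.

Lemma moment_set0 (g : nat -> config n) : moment g b finset.set0 = \sum_t b t.
Proof. by apply: eq_bigr => t _; rewrite walsh0 mulr1. Qed.

Lemma moment_const (g : nat -> config n) u w : u != w ->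
  (forall t, (t <= len)%N -> g t u = g 0 u) ->
  moment g b [set u; w] = (-1) ^+ g 0 u * moment g b [set w].
Proof.
move=> uw gu; rewrite /moment mulr_sumr; apply: eq_bigr => t _.
rewrite walsh1 /walsh big_setU1 ?inE //= big_set1 gu; last by rewrite -ltnS.
ring.
Qed.

Lemma affine_relation_transfer : affine_relation gam' b.
Proof.
case: b_rel => b0 b1; split; first by rewrite moment_set0 -(moment_set0 gam).
move=> v; case: (agree v) => gv.
  rewrite -(b1 v); apply: eq_bigr => t _; rewrite !walsh1 gv //; by rewrite -ltnS.
rewrite /moment (eq_bigr (fun t => b t * (-1) ^+ gam' 0 v)).
  by rewrite -mulr_suml -(moment_set0 gam) b0 mul0r.
by move=> t _; rewrite walsh1 (gv t _).2 // -ltnS.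
Qed.

(** If a node of the pair never moves, its constant sign factors out and leaves a moment of degree
    one, which vanishes for both sequences. *)
Lemma moment_transfer (e : {set 'I_n}) : #|e| = 2%N -> moment gam' b e = moment gam b e.
Proof.
move=> /eqP/cards2P[u [w [uw ->]]].
have [_ c'] := affine_relation_transfer; have [_ c] := b_rel.
case: (agree u) => gu; last first.
  rewrite !moment_const ?c ?c' ?mulr0 // => t tl; by have [] := gu t tl.
case: (agree w) => gw; last first.
  rewrite finset.setUC !moment_const ?c ?c' ?mulr0 //; rewrite 1?eq_sym //.
  - by move=> t tl; have [] := gw t tl.
  - by move=> t tl; have [] := gw t tl.
apply: eq_bigr => t _; rewrite /walsh !big_setU1 ?inE //= !big_set1 gu ?gw //; by rewrite -ltnS.
Qed.

End Transfer.

Definition code n len := {ffun 'I_len -> ('I_n * bool) * ('I_n * bool)}.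

(* A code lists the two nodes of each move (equal for a single flip) with their
   initial values; nodes that never move are set to [false]. *)
Definition decode n len (z : code n len) (t : nat) : config n :=
  [ffun v => [exists i, ((z i).1.1 == v) && (z i).1.2 || ((z i).2.1 == v) && (z i).2.2] (+)
    odd (\sum_(i < len | (i < t)%N) (((z i).1.1 == v) || ((z i).2.1 == v)))].

Lemma card_code n len : #|{: code n len}| = ((4 * n ^ 2) ^ len)%N.
Proof.
rewrite card_ffun !card_prod !card_ord card_bool; congr (_ ^ _)%N; lia.
Qed.

Lemma gam_parity n (gam : nat -> config n) t v : gam t v = gam 0 v (+) odd (occ gam v t).
Proof.
elim: t => [|t IH]; first by rewrite /occ big_ord0 addbF.
rewrite occS oddD addbA -IH /flips oddb; case: (gam t v); by case: (gam t.+1 v).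
Qed.

Section Encode.
Variables (n len : nat) (gam : nat -> config n).
Hypothesis gam_inj : forall s t, (s <= len)%N -> (t <= len)%N -> gam s = gam t -> s = t.
Hypothesis gam_step : forall t, (t < len)%N -> (#|[set v | flips gam t v]%SET| <= 2)%N.

(** Initial values are recorded for moved nodes only, which keeps the number of codes free of a
    factor [2 ^ n]. *)
Lemma encode : exists z : code n len, forall v,
  (forall t, (t <= len)%N -> gam t v = decode z t v) \/
  (forall t, (t <= len)%N -> gam t v = gam 0 v /\ decode z t v = decode z 0 v).
Proof.
have [pq pqP] := fin_all_exists (endpoints gam_inj gam_step).
pose p i := (pq i).1; pose q i := odflt (p i) (pq i).2.
exists [ffun i => ((p i, gam 0 (p i)), (q i, gam 0 (q i)))] => v.
have flE (i : 'I_len) : flips gam i v = (p i == v) || (q i == v).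
  have [-> _] := pqP i; rewrite /q -/(p i) [v == _]eq_sym.
  case: (pq i).2 => [u|] /=; first by rewrite (inj_eq Some_inj).
  by rewrite orbF orbb.
have occE t : (t <= len)%N -> (\sum_(i < len | (i < t)%N) ((p i == v) || (q i == v)) = occ gam v t)%N.
  move=> tl; rewrite /occ (big_ord_widen len (fun i => (flips gam i v : nat)) tl).
  by apply: eq_bigr => i _; rewrite flE.
have decE t : (t <= len)%N -> decode [ffun i => ((p i, gam 0 (p i)), (q i, gam 0 (q i)))] t v =
    [exists i, (p i == v) && gam 0 (p i) || (q i == v) && gam 0 (q i)] (+) odd (occ gam v t).
  move=> tl; rewrite ffunE -occE //; congr (_ (+) odd _).
    by apply: eq_existsb => i; rewrite ffunE.
  by apply: eq_bigr => i _; rewrite ffunE.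
have [/existsP[i fi]|nf] := boolP [exists i : 'I_len, flips gam i v]; [left|right] => t tl.
  rewrite decE // gam_parity; congr (_ (+) _).
  apply/idP/existsP => [g0|[j]].
    exists i; move: fi; rewrite flE => /orP[/eqP->|/eqP->]; by rewrite eqxx g0 ?orbT.
  by case/orP => /andP[/eqP->].
have o0 s : (s <= len)%N -> occ gam v s = 0%N.
  move=> sl; rewrite -occE // big1 // => j _; rewrite -flE.
  by apply/eqP; rewrite eqb0; apply: contraNN nf => fj; apply/existsP; exists j.
by rewrite !decE // (gam_parity gam t) !o0 // !addbF.
Qed.

End Encode.

(** * Cuts as linear forms in the edge weights *)

Section CutForm.
Variables (R : realType) (n : nat).

Lemma cutE (g : config n) (f : edge n) : 2 * (Defs.cut g f)%:R = 1 - walsh (val f) g :> int.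
Proof.
have := valP f => /cards2P[u [w [uw fE]]].
rewrite /Defs.cut fE /walsh big_setU1 ?inE //= big_set1.
have -> : [exists u0 in [set u; w]%SET, exists v in [set u; w]%SET, g u0 != g v] = (g u != g w).
  apply/existsP/idP => [[a /andP[aE /existsP[c /andP[cE]]]]|guw]; last first.
    by exists u; rewrite set21; apply/existsP; exists w; rewrite set22.
  by case/set2P: aE => ->; case/set2P: cE => ->; rewrite ?eqxx // eq_sym.
by case: (g u); case: (g w).
Qed.

Definition cut_form len (gam : nat -> config n) (b : 'I_len.+1 -> int) (f : edge n) : int :=
  \sum_t b t * (Defs.cut (gam t) f)%:R.

Lemma cut_formE len (gam : nat -> config n) (b : 'I_len.+1 -> int) f :
  affine_relation gam b -> 2 * cut_form gam b f = - moment gam b (val f).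
Proof.
case=> b0 _; rewrite /cut_form mulr_sumr -[RHS]add0r -[X in X - _]b0 /moment -sumrB.
by apply: eq_bigr => t _; rewrite mulrCA cutE walsh0; ring.
Qed.

Lemma cut_form_le len (gam : nat -> config n) (b : 'I_len.+1 -> int) f :
  (forall t, `|b t| <= 2) -> `|cut_form gam b f| <= (2 * len.+1)%:Z.
Proof.
move=> b2; apply: le_trans (ler_norm_sum _ _ _) _.
apply: (@le_trans _ _ (\sum_(t < len.+1) 2)).
  apply: ler_sum => t _; apply: le_trans (b2 t); rewrite normrM.
  by case: Defs.cut; rewrite ?normr1 ?mulr1 // normr0 mulr0.
by rewrite sumr_const card_ord; lia.
Qed.

Lemma sum_obj len (gam : nat -> config n) (b : 'I_len.+1 -> int) (x : edge n -> R) :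
  \sum_t (b t)%:~R * obj x (gam t) = \sum_f x f * (cut_form gam b f)%:~R.
Proof.
rewrite /obj; under eq_bigr do rewrite mulr_sumr.
rewrite exchange_big; apply: eq_bigr => f _ /=.
rewrite /cut_form rmorph_sum mulr_sumr; apply: eq_bigr => t _ /=.
by rewrite rmorphM /= rmorph_nat; ring.
Qed.

End CutForm.

(** A triangular system of forms, stated through moments alone, so that it passes from a window to
    its decoded version. *)
Definition pivotal n len (gam : nat -> config n) (E : {set edge n}) :=
  forall e, e \in E -> exists b : 'I_len.+1 -> int,
  [/\ forall t, `|b t| <= 2, affine_relation gam b, cut_form gam b e != 0 &
      forall e', e' \in E -> cut_form gam b e' != 0 -> (weight (val e) <= weight (val e'))%N].

Lemma pivotal_leading n len D (gam : nat -> config n) : exists E : {set edge n},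
  #|E| = #|leading_pairs len D gam| /\ pivotal len gam E.
Proof.
pose E := [set e : edge n | val e \in leading_pairs len D gam]%SET; exists E; split.
  rewrite -(card_imset _ val_inj); apply: eq_card => e.
  apply/imsetP/idP => [[e' e'E ->]|eL]; first by rewrite inE in e'E.
  have e2 : #|e| == 2%N by move: eL; rewrite inE => /andP[].
  by exists (exist _ e e2) => //; rewrite inE.
have half (b : 'I_len.+1 -> int) f : affine_relation gam b -> (cut_form gam b f != 0) = (moment gam b (val f) != 0).
  move=> bc; congr (~~ _); rewrite -[in RHS]oppr_eq0 -cut_formE //.
  by rewrite mulf_eq0.
move=> e; rewrite inE inE => /and3P[_ _ /asboolP[b [b2 bc be bmin]]].
exists b; split=> //; first by rewrite half.
move=> e'; rewrite inE inE => /and3P[/eqP e'2 e'l _]; rewrite half // => h.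
exact: bmin.
Qed.

Lemma pivotal_transfer n len (gam gam' : nat -> config n) (E : {set edge n}) :
  (forall v,
    (forall t, (t <= len)%N -> gam t v = gam' t v) \/
    (forall t, (t <= len)%N -> gam t v = gam 0 v /\ gam' t v = gam' 0 v)) ->
  pivotal len gam E -> pivotal len gam' E.
Proof.
move=> agree piv e eE; have [b [b2 bc be bmin]] := piv e eE.
have bc' := affine_relation_transfer agree bc.
have same f : cut_form gam' b f = cut_form gam b f.
  have : 2 * cut_form gam' b f = 2 * cut_form gam b f.
    rewrite !cut_formE // (moment_transfer agree bc) //; exact/eqP/(valP f).
  lia.
by exists b; split; rewrite ?same // => e' e'E; rewrite same => /bmin; apply.
Qed.

Local Open Scope classical_set_scope.
Local Open Scope ring_scope.

(** * Probability of small linear forms *)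

Lemma density_le (R : realType) (mu : probability (measurableTypeR R) R) (phi : R)
    (A : set R) : has_density_bounded_by mu phi -> measurable A ->
  (mu A <= phi%:E * lebesgue_measure A)%E.
Proof.
move=> [f [mf fphi muE]] mA; rewrite muE // -integral_cst //.
apply: ge0_le_integral => //.
- by move=> x _; rewrite lee_fin; have /andP[] := fphi x.
- by apply/measurable_EFinP; exact: measurable_funTS.
- by move=> x _; rewrite lee_fin; have /andP[] := fphi x.
Qed.

Section FiniteUnion.
Variables (R : realType) (d : measure_display) (T : measurableType d) (P : probability T R).
Variables (I : finType) (Q : pred I) (A : I -> set T).
Hypothesis mA : forall i, Q i -> measurable (A i).

Lemma finite_union_bound :
  (P (\big[setU/set0]_(i | Q i) A i) <= \sum_(i | Q i) P (A i))%E.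
Proof.
pose K (B : set T) (s : \bar R) := measurable B /\ (P B <= s)%E.
suff : K (\big[setU/set0]_(i | Q i) A i) (\sum_(i | Q i) P (A i))%E by case.
apply: big_rec2 => [|i s B Qi [mB Bs]]; first by split=> //; rewrite measure0.
split; first by apply: measurableU => //; exact: mA.
by apply: (le_trans (measureU2 P (mA Qi) mB)); exact: leeD.
Qed.

Lemma mem_finite_union i w : Q i -> A i w -> (\big[setU/set0]_(i | Q i) A i) w.
Proof. by move=> Qi Aw; rewrite (bigD1 i) //=; left. Qed.

End FiniteUnion.

Section LinearForms.
Variables (R : realType) (d : measure_display) (T : measurableType d) (P : probability T R).
Variables (F : finType) (X : F -> {RV P >-> R}) (phi delta : R).
Variable D : F -> probability (measurableTypeR R) R.
Hypothesis delta_gt0 : 0 < delta.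
Hypothesis phi_gt0 : 0 < phi.
Hypothesis D_density : forall f, has_density_bounded_by (D f) phi.
Hypothesis X_law : forall f, has_law (X f) (D f).
Hypothesis X_indep : mutually_independent X.

Definition cell (k : int) : set R := `[k%:~R * delta, (k + 1)%:~R * delta[%classic.

Lemma measurable_cell f k : measurable (X f @^-1` cell k).
Proof. by apply: measurable_funPTI; exact: measurable_itv. Qed.

Lemma prob_cell f k : (P (X f @^-1` cell k) <= (phi * delta)%:E)%E.
Proof.
have := X_law f (measurable_itv `[k%:~R * delta, (k + 1)%:~R * delta[).
rewrite /distribution /= /pushforward => ->.
apply: le_trans (density_le (D_density f) _) _; first exact: measurable_itv.
rewrite lebesgue_measure_itv /= lte_fin.
have -> : k%:~R * delta < (k + 1)%:~R * delta.
  by rewrite ltr_pM2r // ltr_int; lia.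
rewrite -EFinB -EFinM lee_fin rmorphD /= mulrDl mul1r.
by rewrite addrAC subrr add0r.
Qed.

Lemma sum_prob_cell f (m : nat) (N : int) :
  \sum_(k < m) fine (P (X f @^-1` cell (k%:Z - N))) <= 1.
Proof.
rewrite -lee_fin -sumEFin.
rewrite (eq_bigr (fun k : 'I_m => P (X f @^-1` cell (k%:Z - N)))); last first.
  by move=> k _; rewrite fineK // fin_num_measure //; exact: measurable_cell.
rewrite -(@measure_bigsetU _ _ _ P (fun k : nat => X f @^-1` cell (k%:Z - N))) //.
- by apply: probability_le1; apply: bigsetU_measurable => k _; exact: measurable_cell.
- by move=> k; exact: measurable_cell.
apply/trivIsetP => i j _ _ ij; rewrite -subset0 => w [].
rewrite /cell /= !in_itv /= => /andP[i1 i2] /andP[j1 j2].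
have := le_lt_trans i1 j2; have := le_lt_trans j1 i2.
rewrite !ltr_pM2r // !ltr_int; move/eqP: ij; lia.
Qed.

Variables (E : {set F}) (V : F -> F -> int) (wt : F -> nat) (A : nat).
Hypothesis wt_inj : injective wt.
Hypothesis V_diag : forall e, e \in E -> V e e != 0.
Hypothesis V_tri : forall e e', e \in E -> e' \in E -> V e e' != 0 -> (wt e <= wt e')%N.
Hypothesis V_le : forall e f, e \in E -> `|V e f| <= A%:Z.

Let W := (A * #|F|).+1.

(** Round every weight to a grid of mesh [delta]. A form of size at most [delta] becomes an integer
    form of size at most [W]: 1 for the form and [A] for each rounding error. The boxes passing this
    test are counted by [pivot_count] and weighed, by independence, with [product_weight]. *)
Lemma linear_forms_bound : exists B : set T, [/\ measurable B,
  (P B <= (((2 * W).+1%:R * (phi * delta)) ^+ #|E|)%:E)%E &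
  forall w, (forall f, `|X f w| <= 1) ->
    (forall e, e \in E -> `|\sum_f (V e f)%:~R * X f w| <= delta) -> B w].
Proof.
(* Chosen so that the cells of index between [- N] and [N] cover [-1, 1]. *)
pose N := (Num.trunc delta^-1).+1.
have N_gt : delta^-1 < N%:R.
  by rewrite /N truncnS_gt.
pose idx (k : 'I_(2 * N).+1) : int := k%:Z - N%:Z.
have idx_inj : injective idx.
  by move=> k k' /addIr [] /val_inj.
pose S : {set {ffun F -> 'I_(2 * N).+1}} :=
  [set z : {ffun F -> 'I_(2 * N).+1} | [forall e in E, `|\sum_f V e f * idx (z f)| <= W%:Z]]%SET.
pose box (z : {ffun F -> 'I_(2 * N).+1}) : set T :=
  \bigcap_(f in [set` [set: F]%SET]) (X f @^-1` cell (idx (z f))).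
have mbox z : measurable (box z).
  apply: fin_bigcap_measurable => // f _; exact: measurable_cell.
exists (\big[setU/set0]_(z in S) box z); split.
- by apply: bigsetU_measurable => z _.
- apply: le_trans (finite_union_bound _ _) _; first by move=> z _.
  pose pr f k := fine (P (X f @^-1` cell (idx k))).
  have boxE z : P (box z) = (\prod_f pr f (z f))%:E.
    rewrite /box (X_indep [set: F]%SET (fun f => measurable_itv _)) -prodEFin.
    apply: eq_big => [f|f _]; first by rewrite finset.in_setT.
    by rewrite fineK // fin_num_measure //; exact: measurable_cell.
  under eq_bigr do rewrite boxE.
  rewrite sumEFin lee_fin; apply: product_weight.
  + by move=> f k; rewrite /pr fine_ge0.
  + move=> f k; rewrite -lee_fin fineK ?prob_cell // fin_num_measure //.
    exact: measurable_cell.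
  + by move=> f; exact: sum_prob_cell.
  + move=> y; apply: (pivot_count idx_inj wt_inj V_diag V_tri).
    by move=> z; rewrite inE => /forall_inP.
move=> w X1 small.
pose k f := Num.floor (X f w / delta).
have kN f : `|k f| <= N%:Z.
  have x1 : `|X f w / delta| <= delta^-1.
    rewrite normrM (gtr0_norm (x := delta^-1)) ?invr_gt0 //.
    by rewrite ler_piMl // ltW // invr_gt0.
  have := floor_itv (X f w / delta); rewrite -/(k f) => /andP[k1 k2].
  move: x1; rewrite ler_norml => /andP[x1 x2].
  have u : (k f)%:~R < N%:Z%:~R :> R by apply: le_lt_trans N_gt; apply: le_trans x2.
  have l : (- N%:Z)%:~R < (k f + 1)%:~R :> R.
    by apply: le_lt_trans k2; apply: le_trans x1; rewrite rmorphN /= lerN2 ltW.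
  move: u l; rewrite !ltr_int; lia.
have zlt f : (absz (k f + N%:Z)%R < (2 * N).+1)%N by have := kN f; lia.
pose z : {ffun F -> 'I_(2 * N).+1} := [ffun f => Ordinal (zlt f)].
have idxz f : idx (z f) = k f.
  by rewrite /idx ffunE /=; have := kN f; lia.
apply: (@mem_finite_union _ _ _ _ _ z).
  rewrite inE; apply/forall_inP => e eE.
  have kx f : `|X f w / delta - (k f)%:~R| <= 1.
    have := floor_itv (X f w / delta); rewrite -/(k f) => /andP[k1 k2].
    rewrite ger0_norm ?subr_ge0 // lerBlDl; apply: ltW; move: k2.
    by rewrite rmorphD.
  rewrite -(ler_int R) intr_norm rmorph_sum /=.
  have -> : \sum_f (V e f * idx (z f))%:~R =
      \sum_f (V e f)%:~R * X f w / delta - \sum_f (V e f)%:~R * (X f w / delta - (k f)%:~R) :> R.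
    by rewrite -sumrB; apply: eq_bigr => f _; rewrite idxz rmorphM /=; ring.
  apply: le_trans (ler_normB _ _) _.
  rewrite -[(W%:Z)%:~R]/(W%:R : R) /W -natr1 [X in X <= _]addrC; apply: lerD.
    apply: le_trans (ler_norm_sum _ _ _) _.
    apply: (@le_trans _ _ (\sum_(f : F) A%:R)).
      apply: ler_sum => f _; rewrite normrM -[leRHS]mulr1; apply: ler_pM => //.
      by rewrite -intr_norm -[A%:R]/(A%:Z%:~R) ler_int V_le.
    by rewrite sumr_const -[_ *+ _]mulr_natr -natrM.
  rewrite -mulr_suml normrM (gtr0_norm (x := delta^-1)) ?invr_gt0 //.
  by rewrite ler_pdivrMr // mul1r small.
move=> f _; rewrite /cell /= in_itv /= idxz.
have := floor_itv (X f w / delta); rewrite -/(k f) => /andP[k1 k2].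
by rewrite -ler_pdivlMr // k1 -ltr_pdivrMr.
Qed.

End LinearForms.

(** Mass 1 sits on an interval of length 2. This lower bound on [phi] later absorbs an additive
    constant into a multiple of [phi]. *)
Lemma density_ge_half (R : realType) (mu : probability (measurableTypeR R) R) (phi : R) :
  supported_on_unit mu -> has_density_bounded_by mu phi -> 1 <= 2 * phi.
Proof.
move=> supp dens; have := density_le dens (measurable_itv `[-1, 1]).
rewrite supp lebesgue_measure_itv /= lte_fin.
have -> : (-1 : R) < 1 by lra.
by rewrite -EFinB -EFinM lee_fin; lra.
Qed.

Section Measurability.
Variables (R : realType) (n : nat) (d : measure_display) (T : measurableType d).
Variables (P : probability T R) (X : edge n -> {RV P >-> R}).

Lemma measurable_obj g : measurable_fun setT (fun w => Defs.obj (fun e => X e w) g).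
Proof.
apply: measurable_sum => e; apply: measurable_funM => //.
Qed.

(** The event depends only on the finite table of comparisons between objectives, so it is a finite
    union of measurable level sets. *)
Lemma measurable_terminates (t : R) :
  measurable [set w : T | twoFLIP_terminates_within (fun e => X e w) t].
Proof.
pose table w : {ffun config n * config n -> bool} :=
  [ffun p => Defs.obj (fun e => X e w) p.1 < Defs.obj (fun e => X e w) p.2].
set G := [set w | _].
have G_table w w' : table w = table w' -> G w -> G w'.
  move=> /ffunP tw Gw g s ps; apply: (Gw g s).
  have lt g1 g2 : (Defs.obj (fun e => X e w) g1 < Defs.obj (fun e => X e w) g2) =
      (Defs.obj (fun e => X e w') g1 < Defs.obj (fun e => X e w') g2).
    by have := tw (g1, g2); rewrite !ffunE.
  rewrite (@eq_path _ _ (twoFLIP_step (fun e => X e w'))) // => g1 g2 /=.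
  rewrite /twoFLIP_step /= /improving2 lt /admissible_move; congr (_ && (_ ==> _)).
  by apply: eq_forallb => u; rewrite lt.
pose lev (b : {ffun config n * config n -> bool}) : set T :=
  \bigcap_(p in [set` [set: config n * config n]%SET])
    ((fun w => Defs.obj (fun e => X e w) p.1 < Defs.obj (fun e => X e w) p.2) @^-1` [set b p]).
have mlev b : measurable (lev b).
  apply: fin_bigcap_measurable => // p _.
  rewrite -[X in measurable X]setTI; apply: measurable_fun_ltr => //; exact: measurable_obj.
have levE b w : lev b w <-> table w = b.
  split=> [lw|<- p _]; last by rewrite /= ffunE.
  by apply/ffunP => p; rewrite ffunE; apply: (lw p); rewrite /= finset.in_setT.
have -> : G = \bigcup_(b in [set b | exists2 w, G w & table w = b]) lev b.
  apply/seteqP; split=> [w Gw|w [b [w' Gw' <-] /levE tw]].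
    by exists (table w); [exists w|apply/levE].
  by apply: G_table Gw'.
by apply: fin_bigcup_measurable => // b _.
Qed.

End Measurability.

Lemma card_edge n : (#|{: edge n}| <= n ^ 2)%N.
Proof.
rewrite card_sig -[X in (_ <= X)%N]/(n * n)%N.
rewrite (eq_card (B := [set e : {set 'I_n} | (e \subset [set: 'I_n]%SET) && (#|e| == 2%N)]%SET)).
  rewrite cards_draws cardsT card_ord bin2; case: n => // n.
  by rewrite /= -divn2; apply: leq_trans (leq_div _ _) _; rewrite leq_mul2l leqnSn orbT.
by move=> e; rewrite !inE finset.subsetT.
Qed.

(** After cancelling the common term [2 * 2 ^ n], this is uniqueness of a binary expansion with two
    digits. *)
Lemma weight_inj n : injective (fun e : edge n => weight (val e)).
Proof.
have pair (e : edge n) : exists u w : 'I_n, (u < w)%N /\ val e = [set u; w]%SET.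
  have /cards2P[u [w [uw eE]]] := valP e.
  case: (ltngtP u w) => [lt|lt|/val_inj eq]; last by rewrite eq eqxx in uw.
    by exists u, w.
  by exists w, u; rewrite finset.setUC.
move=> e e'; have [u [w [uw eE]]] := pair e; have [u' [w' [uw' eE']]] := pair e'.
rewrite eE eE' /weight !big_setU1 ?inE ?neq_ltn ?uw ?uw' //= !big_set1.
have top (a c f : nat) : (a < c)%N -> (c < f)%N -> (2 ^ a + 2 ^ c < 2 ^ f)%N.
  move=> ac cf; apply: (@leq_trans (2 ^ c.+1)); last by rewrite leq_exp2l.
  by rewrite expnS mul2n -addnn ltn_add2r ltn_exp2l.
move=> h.
have {}h : (2 ^ u + 2 ^ w = 2 ^ u' + 2 ^ w')%N by move: h; lia.
have ww : w = w'.
  apply: val_inj; case: (ltngtP w w') => // lt.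
    have := top u w w' uw lt; lia.
  have := top u' w' w uw' lt; lia.
move: h; rewrite ww => /addIn /eqP; rewrite eqn_exp2l // => /eqP/val_inj uu.
by apply: val_inj; rewrite eE eE' ww uu.
Qed.

(** * The bad event attached to a code *)

Section Events.
Variables (R : realType) (n : nat) (d : measure_display) (T : measurableType d).
Variables (P : probability T R) (X : edge n -> {RV P >-> R}) (phi delta eps eta : R).
Variable D : edge n -> probability (measurableTypeR R) R.
Hypothesis delta_gt0 : 0 < delta.
Hypothesis phi_gt0 : 0 < phi.
Hypothesis D_density : forall f, has_density_bounded_by (D f) phi.
Hypothesis X_law : forall f, has_law (X f) (D f).
Hypothesis X_indep : mutually_independent X.
Hypothesis wt_inj : injective (fun e : edge n => weight (val e)).
Variables (len lam : nat).
Hypothesis eta_le : 0 <= eta <= 1.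
Hypothesis lam_bound :
  (2 * (2 * len.+1 * #|{: edge n}|).+1).+1%:R * (phi * delta) <= eta ^+ lam.
Hypothesis gain_bound : 2 * len.+1%:R * eps <= delta.

(** [B] must depend on the code alone for a union bound. It is built from a pivotal set of the
    decoded window and is empty if no large one exists, a case excluded for actual runs by
    transfer. *)
Lemma code_event (z : code n len) : exists B : set T, [/\ measurable B,
  (P B <= (eta ^+ len)%:E)%E &
  forall w (gam : nat -> config n) E, (forall f, `|X f w| <= 1) ->
    (forall v, (forall t, (t <= len)%N -> gam t v = decode z t v) \/
      (forall t, (t <= len)%N -> gam t v = gam 0 v /\ decode z t v = decode z 0 v)) ->
    pivotal len gam E -> (len <= lam * #|E|)%N ->
    (forall t, (t <= len)%N -> `|Defs.obj (fun e => X e w) (gam t) -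
      Defs.obj (fun e => X e w) (gam 0)| <= eps) -> B w].
Proof.
have [[E [piv lenE]]|none] := pselect (exists E, pivotal len (decode z) E /\ (len <= lam * #|E|)%N);
  last first.
  exists set0; split=> //; first by rewrite measure0 lee_fin exprn_ge0 //; case/andP: eta_le.
  move=> w gam E _ agree piv lenE _; apply: none; exists E; split=> //.
  exact: pivotal_transfer agree piv.
have /choice[b bP] : forall e, exists b : 'I_len.+1 -> int, e \in E ->
    [/\ forall t, `|b t| <= 2, affine_relation (decode z) b, cut_form (decode z) b e != 0 &
      forall e', e' \in E -> cut_form (decode z) b e' != 0 -> (weight (val e) <= weight (val e'))%N].
  by move=> e; have [/piv[b bP]|eE] := boolP (e \in E); [exists b|exists (fun=> 0)].
have [|||B [mB PB Bw]] := @linear_forms_bound R d T P _ X phi delta D delta_gt0 phi_gt0 D_density X_law X_indep E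
  (fun e => cut_form (decode z) (b e)) _ (2 * len.+1) wt_inj.
- by move=> e /bP[].
- by move=> e e' eE e'E; have [_ _ _] := bP e eE; apply.
- by move=> e f eE; have [b2 _ _ _] := bP e eE; exact: cut_form_le.
exists B; split=> //.
  apply: le_trans PB _; rewrite lee_fin.
  have [eta0 eta1] := andP eta_le.
  apply: le_trans (lerXn2r _ _ _ lam_bound) _; rewrite ?nnegrE ?exprn_ge0 //.
    by rewrite mulr_ge0 // ltW // mulr_gt0.
  by rewrite -exprM; apply: ler_wiXn2l.
move=> w gam E' X1 agree _ _ small; apply: Bw => // e eE.
have [b2 bc _ _] := bP e eE.
have agree' v : (forall t, (t <= len)%N -> decode z t v = gam t v) \/
    (forall t, (t <= len)%N -> decode z t v = decode z 0 v /\ gam t v = gam 0 v).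
  by case: (agree v) => h; [left|right] => t tl; [rewrite h|have [] := h t tl].
have bc' := affine_relation_transfer agree' bc.
have same f : cut_form (decode z) (b e) f = cut_form gam (b e) f.
  have : 2 * cut_form (decode z) (b e) f = 2 * cut_form gam (b e) f.
    by rewrite !cut_formE // (moment_transfer agree' bc) //; exact/eqP/(valP f).
  lia.
(* Subtracting the initial objective is free, because the coefficients of an affine relation sum to
   zero. *)
have -> : \sum_f (cut_form (decode z) (b e) f)%:~R * X f w =
    \sum_t (b e t)%:~R * (Defs.obj (fun e => X e w) (gam t) - Defs.obj (fun e => X e w) (gam 0)) :> R.
  under [RHS]eq_bigr do rewrite mulrBr.
  rewrite sumrB sum_obj -mulr_suml -rmorph_sum -(moment_set0 _ gam) bc'.1 mul0r subr0.
  by apply: eq_bigr => f _; rewrite same mulrC.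
apply: le_trans gain_bound; apply: le_trans (ler_norm_sum _ _ _) _.
apply: (@le_trans _ _ (\sum_(t < len.+1) 2 * eps)); last first.
  by rewrite sumr_const card_ord -[_ *+ _]mulr_natl mulrCA mulrA.
apply: ler_sum => t _; rewrite normrM; apply: ler_pM => //.
  by rewrite -intr_norm -[2]/(2%:~R) ler_int.
by apply: small; rewrite -ltnS.
Qed.

End Events.

(** * Runs of 2-FLIP *)

Section Runs.
Variables (R : realType) (n : nat) (x : edge n -> R).

Definition improving_run (len : nat) (gam : nat -> config n) :=
  forall t, (t < len)%N -> improving2 x (gam t) (gam t.+1).

Lemma run_lt len gam s t : improving_run len gam -> (s < t)%N -> (t <= len)%N ->
  Defs.obj x (gam s) < Defs.obj x (gam t).
Proof.
move=> run; elim: t => // t IH; rewrite ltnS leq_eqVlt => st tl.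
have /andP[_ lt] := run t tl.
by case/orP: st => [/eqP->//|st]; apply: lt_trans lt; apply: IH => //; exact: ltnW.
Qed.

Lemma run_le len gam s t : improving_run len gam -> (s <= t)%N -> (t <= len)%N ->
  Defs.obj x (gam s) <= Defs.obj x (gam t).
Proof.
move=> run; rewrite leq_eqVlt => /orP[/eqP->//|st tl].
exact/ltW/(run_lt run).
Qed.

Lemma run_inj len gam s t : improving_run len gam -> (s <= len)%N -> (t <= len)%N ->
  gam s = gam t -> s = t.
Proof.
move=> run sl tl e; case: (ltngtP s t) => // lt.
  by have := run_lt run lt tl; rewrite e ltxx.
by have := run_lt run lt sl; rewrite e ltxx.
Qed.

Lemma run_step len gam t : improving_run len gam -> (t < len)%N ->
  (#|[set v | flips gam t v]%SET| <= 2)%N.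
Proof.
by move=> run tl; have /andP[] := run t tl.
Qed.

(** The objective is monotone along the run, so a small total gain forces small gains in every
    window. *)
Lemma slow_run_code K (gam : nat -> config n) (eps : R) :
  (0 < K)%N -> (2 * (n * (2 ^ 10 * K)) <= 2 ^ K)%N -> improving_run (2 ^ K) gam ->
  Defs.obj x (gam (2 ^ K)%N) - Defs.obj x (gam 0%N) <= eps ->
  exists (k : 'I_K) (z : code n (2 ^ k)) (gam' : nat -> config n) (E : {set edge n}),
  [/\ forall v, (forall t, (t <= 2 ^ k)%N -> gam' t v = decode z t v) \/
        (forall t, (t <= 2 ^ k)%N -> gam' t v = gam' 0 v /\ decode z t v = decode z 0 v),
      pivotal (2 ^ k) gam' E, (2 ^ k <= scale_const K * #|E|)%N &
      forall t, (t <= 2 ^ k)%N -> `|Defs.obj x (gam' t) - Defs.obj x (gam' 0%N)| <= eps].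
Proof.
move=> K0 nD run gain.
have [k [s [kK sK le]]] := leading_window K0 nD
  (fun s t => run_inj (s := s) (t := t) run) (fun t => run_step (t := t) run).
pose g := window gam s.
have run' : improving_run (2 ^ k) g.
  move=> t tk; rewrite /g /window addnS; apply: run.
  by apply: leq_trans sK; rewrite ltn_add2l.
have [z zP] := encode (fun s t => run_inj (s := s) (t := t) run')
  (fun t => run_step (t := t) run').
have [E [cE piv]] := pivotal_leading (2 ^ k) (2 ^ 10 * K) g.
exists (Ordinal kK), z, g, E; split=> //; first by rewrite cE.
move=> t tk; have stK : (s + t <= 2 ^ K)%N by apply: leq_trans sK; rewrite leq_add2l.
rewrite /g /window addn0 ger0_norm; last by rewrite subr_ge0 (run_le run) // leq_addr.
apply: le_trans gain; apply: lerB; first exact: run_le run _ _.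
by apply: (run_le run) => //; apply: leq_trans stK; exact: leq_addr.
Qed.

Lemma obj_le (g : config n) : (forall e, `|x e| <= 1) -> `|Defs.obj x g| <= #|{: edge n}|%:R.
Proof.
move=> x1; apply: le_trans (ler_norm_sum _ _ _) _.
rewrite -sum1_card natr_sum; apply: ler_sum => e _; rewrite normrM.
by case: Defs.cut; rewrite ?normr0 ?mulr0 // normr1 mulr1.
Qed.

(** Cut the run into blocks of length [L]: each gains more than [eps], while the objective varies by
    at most twice the number of edges. *)
Lemma fast_runs_bound L (eps : R) : (0 < L)%N -> 0 < eps -> (forall e, `|x e| <= 1) ->
  (forall gam, improving_run L gam -> eps < Defs.obj x (gam L) - Defs.obj x (gam 0%N)) ->
  forall g s, path (twoFLIP_step x) g s ->
  (size s)%:R <= L%:R * (2 * #|{: edge n}|%:R / eps + 1).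
Proof.
move=> L0 eps0 x1 fast g s ps.
pose gam t := nth g (g :: s) t.
have run : improving_run (size s) gam.
  by move=> t ts; have /andP[] := pathP g ps t ts.
have gain a : (a * L <= size s)%N ->
    a%:R * eps <= Defs.obj x (gam (a * L)%N) - Defs.obj x (gam 0%N).
  elim: a => [|a IH] aL; first by rewrite mul0r subrr.
  have aL' : (a * L <= size s)%N by apply: leq_trans aL; rewrite leq_mul2r leqnSn orbT.
  have blk : improving_run L (window gam (a * L)).
    move=> t tL; rewrite /window addnS; apply: run; apply: leq_trans aL.
    by rewrite mulSnr ltn_add2l.
  have := fast _ blk; rewrite /window addn0 -mulSnr => lt.
  have := IH aL'; rewrite -natr1 mulrDl mul1r; move: lt.
  move: (Defs.obj _ _) (Defs.obj _ _) (Defs.obj _ _) => u v w; lra.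
set a := (size s %/ L)%N.
have := gain a (leq_trunc_div _ _).
have := obj_le (gam (a * L)%N) x1; have := obj_le (gam 0%N) x1.
rewrite !ler_norml => /andP[l1 l2] /andP[l3 l4] l5.
have aB : a%:R <= 2 * #|{: edge n}|%:R / eps.
  rewrite ler_pdivlMr //; move: l1 l2 l3 l4 l5.
  move: (Defs.obj _ _) (Defs.obj _ _) => u v; lra.
apply: (@le_trans _ _ (L%:R * (a%:R + 1))); last first.
  by rewrite ler_wpM2l // lerD2r.
by rewrite natr1 -natrM ler_nat mulnC ltnW // ltn_ceil.
Qed.

End Runs.

(** As [n] is at least 32, each constant costs at most one further factor [n]; for instance
    [8 * n ^ 4] is at most [n ^ 5]. *)
Lemma step_count_nat n L lam : (0 < lam)%N -> (32 <= n)%N -> (L <= 4 * n ^ 2)%N ->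
  (L * (2 * (n ^ 2 * (2 * L.+1 * (4 * L.+1 * n ^ 2 + 3) * (8 * n ^ 4) ^ lam)) + 2) <=
    n ^ (16 + 5 * lam))%N.
Proof.
move=> lam_gt0 n32 LK.
have n_gt0 : (0 < n)%N by apply: leq_trans n32.
have n3 : (4 * n ^ 2 < n ^ 3)%N by rewrite (expnSr n 2); move: (n ^ 2)%N (expn_gt0 n 2); nia.
have L3 : (L.+1 <= n ^ 3)%N by apply: leq_ltn_trans LK n3.
have Q6 : (4 * L.+1 * n ^ 2 + 3 <= n ^ 6)%N.
  have -> : (n ^ 6 = n * (n ^ 3 * n ^ 2))%N by rewrite -expnD -expnS.
  have h : (L.+1 * n ^ 2 <= n ^ 3 * n ^ 2)%N by rewrite leq_mul2r L3 orbT.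
  have : (0 < n ^ 3 * n ^ 2)%N by rewrite muln_gt0 !expn_gt0 n_gt0.
  by rewrite -mulnA; move: (L.+1 * n ^ 2)%N (n ^ 3 * n ^ 2)%N h => u v; nia.
have lamb : ((8 * n ^ 4) ^ lam <= n ^ (5 * lam))%N.
  by rewrite expnM; rewrite leq_exp2r // expnS leq_mul2r; apply/orP; right; lia.
have Yb : (n ^ 2 * (2 * L.+1 * (4 * L.+1 * n ^ 2 + 3) * (8 * n ^ 4) ^ lam) * 2 <=
    n ^ (12 + 5 * lam))%N.
  have -> : (n ^ (12 + 5 * lam) = n ^ 3 * n ^ 3 * n ^ 6 * n ^ (5 * lam))%N by rewrite -!expnD.
  have -> : (n ^ 2 * (2 * L.+1 * (4 * L.+1 * n ^ 2 + 3) * (8 * n ^ 4) ^ lam) * 2 =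
    (4 * n ^ 2) * L.+1 * (4 * L.+1 * n ^ 2 + 3) * (8 * n ^ 4) ^ lam)%N by ring.
  exact: leq_mul (leq_mul (leq_mul (ltnW n3) L3) Q6) lamb.
have -> : (16 + 5 * lam = 3 + (1 + (12 + 5 * lam)))%N by ring.
rewrite expnD leq_mul ?(ltnW L3) // expnD expn1 mulnC.
have : (0 < n ^ (12 + 5 * lam))%N by rewrite expn_gt0 n_gt0.
move=> u0; apply: leq_trans (leq_add Yb (leqnn 2)) _.
apply: (@leq_trans (3 * n ^ (12 + 5 * lam))).
  by move: (n ^ (12 + 5 * lam))%N u0 => u; lia.
by rewrite leq_mul2r; apply/orP; right; apply: leq_trans n32.
Qed.

(** * Union bound over scales and codes *)

Section UnionBound.
Variables (R : realType) (n K : nat) (phi : R).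
Variable D : edge n -> probability (measurableTypeR R) R.
Hypothesis phi_gt0 : 0 < phi.
Hypothesis D_supp : forall e, supported_on_unit (D e).
Hypothesis D_density : forall e, has_density_bounded_by (D e) phi.
Variables (d : measure_display) (T : measurableType d) (P : probability T R).
Variable X : edge n -> {RV P >-> R}.
Hypothesis X_law : forall e, has_law (X e) (D e).
Hypothesis X_indep : mutually_independent X.
Hypothesis n_gt0 : (0 < n)%N.
Hypothesis K_gt0 : (0 < K)%N.
Hypothesis nK : (2 * (n * (2 ^ 10 * K)) <= 2 ^ K)%N.

(** Dominates the number of values of a rounded form, [2 * W + 1], at all scales up to [K]. *)
Definition form_const := (4 * (2 ^ K).+1 * n ^ 2 + 3)%N.

(** [eta] beats the [4 * n ^ 2] codes per move by a factor [2 * n ^ 2]. [delta] makes the cost of a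
    pivot [eta ^+ scale_const K], that is at most [eta] per move, and [eps] keeps the forms below
    [delta]. *)
Let eta : R := (8 * n ^ 4)%N%:R^-1.
Let delta : R := eta ^+ scale_const K / (form_const%:R * phi).
Let eps : R := delta / (2 * (2 ^ K).+1%:R).

Let eta_gt0 : 0 < eta.
Proof. by rewrite invr_gt0 ltr0n muln_gt0 expn_gt0 n_gt0. Qed.

Let eta_le1 : 0 <= eta <= 1.
Proof.
apply/andP; split; first exact: ltW.
by rewrite /eta invf_le1 ?ltr0n ?ler1n ?muln_gt0 ?expn_gt0 ?n_gt0.
Qed.

Let form_const_gt0 : 0 < form_const%:R :> R.
Proof. by rewrite ltr0n /form_const addn_gt0 orbT. Qed.

Let delta_gt0 : 0 < delta.
Proof. by rewrite divr_gt0 ?exprn_gt0 ?mulr_gt0. Qed.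

Let eps_gt0 : 0 < eps.
Proof. by rewrite divr_gt0 // mulr_gt0 // ltr0n. Qed.

(** For each scale the union over codes costs [(2 * n ^ 2) ^ (- 2 ^ k)], at most the inverse of
    [2 * n ^ 2]; there are [K] scales. *)
Lemma bad_event : exists B : set T, [/\ measurable B,
  (P B <= (K%:R / (2 * n ^ 2)%N%:R)%:E)%E &
  forall w, (forall e, `|X e w| <= 1) -> ~ B w ->
    twoFLIP_terminates_within (fun e => X e w)
      ((2 ^ K)%N%:R * (2 * #|{: edge n}|%:R / eps + 1))].
Proof.
have lam_bound k : (k <= K)%N ->
    (2 * (2 * (2 ^ k).+1 * #|{: edge n}|).+1).+1%:R * (phi * delta) <= eta ^+ scale_const K.
  move=> kK.
  have -> : phi * delta = eta ^+ scale_const K / form_const%:R.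
    rewrite /delta; move: (eta ^+ _) => u; field; by rewrite ?gt_eqF.
  rewrite mulrCA ger_pMr ?exprn_gt0 // ler_pdivrMr // mul1r ler_nat.
  rewrite /form_const; have := card_edge n; have : (2 ^ k <= 2 ^ K)%N by rewrite leq_exp2l.
  move: #|_| (2 ^ k)%N (2 ^ K)%N (n ^ 2)%N => m a b c; nia.
have gain_bound k : (k <= K)%N -> 2 * (2 ^ k).+1%:R * eps <= delta.
  move=> kK; rewrite /eps mulrCA ger_pMr // ler_pdivrMr ?mulr_gt0 ?ltr0n // mul1r.
  by rewrite ler_pM2l // ler_nat ltnS leq_exp2l.
have ev (k : 'I_K) (z : code n (2 ^ k)) := code_event delta_gt0 phi_gt0 D_density X_law
  X_indep (@weight_inj n) eta_le1 (lam_bound k (ltnW (ltn_ord k)))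
  (gain_bound k (ltnW (ltn_ord k))) z.
have /choice[B BP] : forall kz : {k : 'I_K & code n (2 ^ k)}, exists B : set T,
    [/\ measurable B, (P B <= (eta ^+ (2 ^ tag kz))%:E)%E &
      forall w (gam : nat -> config n) E, (forall f, `|X f w| <= 1) ->
      (forall v, (forall t, (t <= 2 ^ tag kz)%N -> gam t v = decode (tagged kz) t v) \/
        (forall t, (t <= 2 ^ tag kz)%N -> gam t v = gam 0 v /\ decode (tagged kz) t v = decode (tagged kz) 0 v)) ->
      pivotal (2 ^ tag kz) gam E -> (2 ^ tag kz <= scale_const K * #|E|)%N ->
      (forall t, (t <= 2 ^ tag kz)%N -> `|Defs.obj (fun e => X e w) (gam t) -
        Defs.obj (fun e => X e w) (gam 0)| <= eps) -> B w].
  by move=> [k z]; exact: ev.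
pose tg (k : 'I_K) (z : code n (2 ^ k)) : {k : 'I_K & code n (2 ^ k)} :=
  Tagged (fun k : 'I_K => code n (2 ^ k)) z.
pose bad := \big[setU/set0]_(k < K) \big[setU/set0]_(z : code n (2 ^ k))
  B (tg k z).
have mbad (k : 'I_K) : measurable (\big[setU/set0]_(z : code n (2 ^ k))
    B (tg k z)).
  by apply: bigsetU_measurable => z _; case: (BP (tg k z)).
exists bad; split.
- by apply: bigsetU_measurable => k _.
- apply: le_trans (finite_union_bound P (fun k _ => mbad k)) _.
  apply: (@le_trans _ _ (\sum_(k < K) ((2 * n ^ 2)%N%:R^-1)%:E)); last first.
    by rewrite sumEFin lee_fin sumr_const card_ord -[_ *+ _]mulr_natl.
  apply: lee_sum => k _.
  have mB (z : code n (2 ^ k)) : true -> measurable (B (tg k z)).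
    by case: (BP (tg k z)).
  apply: le_trans (finite_union_bound P mB) _.
  apply: (@le_trans _ _ (\sum_(z : code n (2 ^ k)) (eta ^+ (2 ^ k))%:E)).
    by apply: lee_sum => z _; case: (BP (tg k z)).
  rewrite sumEFin lee_fin sumr_const card_code -[_ *+ _]mulr_natl natrX -exprMn.
  have -> : (4 * n ^ 2)%N%:R * eta = (2 * n ^ 2)%N%:R^-1.
    have -> : eta = ((4 * n ^ 2) * (2 * n ^ 2))%N%:R^-1 by rewrite /eta; congr (_%:R^-1); ring.
    by rewrite (@natrM R (4 * n ^ 2)) invfM mulrA divff ?mul1r // pnatr_eq0 -lt0n muln_gt0 expn_gt0 n_gt0.
  rewrite -[leRHS]expr1; apply: ler_wiXn2l; rewrite ?expn_gt0 //.
  by rewrite invf_le1 ?ltr0n ?ler1n ?muln_gt0 ?expn_gt0 ?n_gt0.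
move=> w X1 nbad; apply: fast_runs_bound => //; first by rewrite expn_gt0.
move=> gam run; rewrite ltNge; apply/negP => slow; apply: nbad.
have [k [z [gam' [E [agree piv lenE small]]]]] := slow_run_code K_gt0 nK run slow.
apply: (mem_finite_union (i := k)) => //; apply: (mem_finite_union (i := z)) => //.
by have [_ _] := BP (tg k z); apply; eauto.
Qed.

(** Failure requires the bad event or a weight outside [-1, 1]; the latter has probability zero. *)
Lemma good_probability (t : R) :
  (2 ^ K)%N%:R * (2 * #|{: edge n}|%:R / eps + 1) <= t ->
  ((1 - K%:R / (2 * n ^ 2)%N%:R)%:E <=
    P [set w : T | twoFLIP_terminates_within (fun e => X e w) t])%E.
Proof.
move=> le_t; have [B [mB PB Bw]] := bad_event.
set G := [set w | _].
have mG : measurable G by exact: measurable_terminates.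
pose S := \bigcap_(e in [set` [set: edge n]%SET]) (X e @^-1` `[-1, 1]).
have mS : measurable S.
  apply: fin_bigcap_measurable => // e _; apply: measurable_funPTI; exact: measurable_itv.
have PS : P S = 1%E.
  rewrite (X_indep [set: edge n]%SET (fun=> measurable_itv `[-1, 1])).
  rewrite big1 // => e _.
  have := X_law e (measurable_itv `[-1, 1]); rewrite /distribution /= /pushforward => ->.
  exact: D_supp.
have sub : ~` G `<=` ~` S `|` B.
  move=> w nG; have [Bw'|nB] := pselect (B w); [by right|left=> Sw; apply: nG].
  move=> g s ps; apply: le_trans le_t; apply: (Bw w) ps => // e.
  by have := Sw e; rewrite /= finset.in_setT in_itv /= => /(_ isT); rewrite ler_norml.
have : (P (~` G) <= (K%:R / (2 * n ^ 2)%N%:R)%:E)%E.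
  apply: le_trans (le_measure P _ _ sub) _; rewrite ?inE.
  - exact: measurableC.
  - by apply: measurableU => //; exact: measurableC.
  apply: (le_trans (measureU2 P (measurableC mS) mB)).
  have PSC : P (~` S) = 0%E by rewrite probability_setC // PS subee.
  suff h : (P (~` S) + P B <= (K%:R / (2 * n ^ 2)%N%:R)%:E)%E by exact: h.
  by rewrite PSC add0e.
rewrite probability_setC //.
have /fineK <- : P G \is a fin_num by rewrite fin_num_measure.
by rewrite -EFinB !lee_fin; lra.
Qed.

Lemma step_count_bound : 1 <= 2 * phi -> (32 <= n)%N -> (2 ^ K <= 4 * n ^ 2)%N ->
  (2 ^ K)%N%:R * (2 * #|{: edge n}|%:R / eps + 1) <=
    phi * n%:R ^+ (16 + 5 * scale_const K).
Proof.
move=> phi1 n32 LK; set L := (2 ^ K)%N in LK *.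
set lam := scale_const K.
have epsE : eps^-1 = phi * (2 * L.+1 * form_const * (8 * n ^ 4) ^ lam)%N%:R.
  have -> : eps^-1 = phi * (2 * L.+1%:R * form_const%:R * (eta ^+ lam)^-1).
    rewrite /eps /delta -/lam -/L; have : eta ^+ lam != 0 by rewrite expf_neq0 ?gt_eqF.
    have : L.+1%:R != 0 :> R by rewrite pnatr_eq0.
    move: form_const_gt0 phi_gt0 => /gt_eqF/negbT c0 /gt_eqF/negbT p0.
    move: (eta ^+ lam) (L.+1%:R : R) c0 => u v c0 v0 u0; field.
    by rewrite c0 p0 v0 u0.
  by rewrite exprVn invrK -natrX -!natrM.
set Y := (2 * L.+1 * form_const * (8 * n ^ 4) ^ lam)%N in epsE *.
apply: (@le_trans _ _ (phi * (L * (2 * (n ^ 2 * Y) + 2))%N%:R)).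
  rewrite epsE natrM [leRHS]mulrCA ler_wpM2l //.
  have : #|{: edge n}|%:R * Y%:R <= (n ^ 2 * Y)%N%:R :> R.
    by rewrite -natrM ler_nat leq_mul2r card_edge orbT.
  move=> /(ler_wpM2l (ltW phi_gt0)).
  rewrite natrD (@natrM R 2); move: (#|_|%:R : R) (Y%:R : R) ((n ^ 2 * Y)%N%:R : R).
  move=> u y v h; rewrite -[2%:R]/(2 : R).
  have -> : 2 * u * (phi * y) = 2 * (phi * (u * y)) by ring.
  lra.
rewrite ler_pM2l // -natrX ler_nat /Y /form_const -/L.
apply: step_count_nat => //.
by rewrite /lam /scale_const muln_gt0 !expn_gt0 K_gt0.
Qed.

End UnionBound.

(** * Choice of the top scale and size of the exponent *)

Definition top_scale n := (2 * (trunc_log 2 n).+1)%N.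

(** [2 ^ top_scale n] exceeds [n ^ 2], which leaves a factor [n] to absorb the logarithm in the
    first bound, and it remains polynomial in [n]. *)
Lemma top_scaleP n : (2 ^ 20 <= n)%N ->
  [/\ (2 * (n * (2 ^ 10 * top_scale n)) <= 2 ^ top_scale n)%N,
      (2 ^ top_scale n <= 4 * n ^ 2)%N & (top_scale n <= 2 * n)%N].
Proof.
move=> n20; rewrite /top_scale; set l := trunc_log 2 n.
have n0 : (0 < n)%N by apply: leq_trans n20; rewrite expn_gt0.
have ln : (2 ^ l <= n)%N by apply: trunc_logP.
have nl : (n < 2 ^ l.+1)%N by apply: trunc_log_ltn.
have l20 : (20 <= l)%N by rewrite -ltnS -(ltn_exp2l _ _ (ltnSn 1)) (leq_ltn_trans n20).
have big : (2 ^ 11 * l.+1 <= 2 ^ l)%N.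
  rewrite -(subnK l20); elim: (l - 20)%N => [|i IH].
    rewrite add0n -[20%N]/(11 + 9)%N expnD leq_mul2l; apply/orP; right.
    by rewrite -[9%N]/(4 + 5)%N expnD.
  rewrite addSn [leqRHS]expnS mulnS mul2n -addnn leq_add //.
  apply: leq_trans IH; by rewrite -[leqLHS]muln1 leq_mul2l.
have LE : (2 ^ (2 * l.+1) = 4 * (2 ^ l * 2 ^ l))%N.
  by rewrite mulnS expnD mul2n -addnn expnD.
split.
- rewrite LE; apply: (@leq_trans (2 * (2 * 2 ^ l * (2 ^ 10 * (2 * l.+1))))).
    rewrite leq_mul2l /= leq_mul2r; apply/orP; right.
    by rewrite -expnS ltnW.
  have -> : (2 * (2 * 2 ^ l * (2 ^ 10 * (2 * l.+1))) = 4 * (2 ^ l * (2 ^ 11 * l.+1)))%N.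
    by rewrite (expnS 2 10); move: (2 ^ 10)%N (2 ^ l)%N => a b; ring.
  by rewrite leq_mul2l /= leq_mul2l big orbT.
- by rewrite LE leq_mul2l /= -mulnn leq_mul.
- rewrite leq_mul2l /=; apply: leq_trans ln; apply: leq_trans big.
  by rewrite leq_pmull // expn_gt0.
Qed.

Section Exponent.
Variable R : realType.

Definition exponent_const : R :=
  16%:R + 5%:R * 2%:R ^+ 27 * (4%:R * ((ln 2%:R)^-1 + 1)) ^+ 3.

Lemma ln2_gt0 : 0 < ln (2%:R : R).
Proof. by rewrite ln_gt0 // ltr1n. Qed.

Lemma exponent_const_gt0 : 0 < exponent_const.
Proof.
have := ln2_gt0; rewrite -invr_gt0 => h.
apply: ltr_pwDl; first by rewrite ltr0n.
apply: mulr_ge0; first by rewrite mulr_ge0 ?exprn_ge0.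
by apply: exprn_ge0; rewrite mulr_ge0 // addr_ge0 // ltW.
Qed.

(** [top_scale n] is of order [ln n] and [scale_const] is cubic, so the exponent is of order
    [ln n ^ 3]; the power 10 is ample once [ln n] is at least 1. *)
Lemma exponent_bound n : (0 < n)%N -> 1 <= ln (n%:R : R) ->
  (16 + 5 * scale_const (top_scale n))%N%:R <= exponent_const * ln n%:R ^+ 10.
Proof.
move=> n0 ln1; set x := ln _ in ln1 *.
have x0 : 0 <= x by apply: le_trans ln1.
have topx : (top_scale n)%:R <= 4%:R * ((ln 2%:R)^-1 + 1) * x.
  rewrite /top_scale; set l := trunc_log 2 n.
  have : l%:R * ln 2%:R <= x.
    rewrite mulr_natl -lnXn ?ltr0n // ler_ln ?posrE ?exprn_gt0 ?ltr0n //.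
    by rewrite -natrX ler_nat; apply: trunc_logP.
  rewrite -ler_pdivlMr ?ln2_gt0 // mulrC => lx.
  have : 0 <= (ln 2%:R)^-1 * x by rewrite mulr_ge0 // invr_ge0 ltW // ln2_gt0.
  rewrite (@natrM R 2) -[l.+1%:R]natr1.
  move: ((ln (2%:R : R))^-1) (l%:R : R) lx => u v; nra.
rewrite /exponent_const; move: (4%:R * _) topx => c topx.
rewrite natrD (@natrM R 5) /scale_const (@natrM R (2 ^ 27)) !natrX [X in _ <= X]mulrDl; apply: lerD.
  by rewrite -[leLHS]mulr1 ler_wpM2l // exprn_ege1.
have : 0 <= 2%:R ^+ 27 :> R by rewrite exprn_ge0.
move: (2%:R ^+ 27) => m m0.
rewrite mulrA -[X in _ <= X]mulrA ler_wpM2l ?mulr_ge0 //.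
apply: (@le_trans _ _ ((c * x) ^+ 3)).
  by apply: lerXn2r => //; rewrite nnegrE ?ler0n //; apply: le_trans topx; rewrite ler0n.
have c0 : 0 <= c.
  rewrite -(@pmulr_lge0 _ x) ?(lt_le_trans ltr01) //; apply: le_trans topx; exact: ler0n.
by rewrite exprMn ler_wpM2l ?exprn_ge0 //; apply: ler_weXn2l.
Qed.

End Exponent.

Unset Implicit Arguments.

Theorem theorem1p2 (R : realType) :
  exists (C : R) (eps : nat -> R),
    [/\ 0 < C,
        eps @ \oo --> (0 : R) &
        forall (n : nat) (phi : R)
          (D : edge n -> probability (measurableTypeR R) R),
        0 < phi ->
        (forall e, supported_on_unit (D e)) ->
        (forall e, has_density_bounded_by (D e) phi) ->
        forall (d : measure_display) (T : measurableType d)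
          (P : probability T R) (X : edge n -> {RV P >-> R}),
        (forall e, has_law (X e) (D e)) ->
        mutually_independent X ->
        let good := [set w : T |
          twoFLIP_terminates_within (fun e => X e w)
            (phi * n%:R `^ (C * ln n%:R ^+ 10))] in
        measurable good /\ ((1 - eps n)%:E <= P good)%E].
Proof.
(* The first threshold serves [top_scaleP], the second makes [ln n] at least 1. *)
pose n0 := maxn (2 ^ 20) (Num.trunc (expR 1 : R)).+1.
(* Below [n0] the bound is trivial. Beyond it the failure probability is at most
   [top_scale n / (2 * n ^ 2)], hence at most [1 / n], which is below [2 / (n + 1)]. *)
pose eps n : R := if (n < n0)%N then 1 else 2%:R * harmonic n.
exists (exponent_const R), eps; split; first exact: exponent_const_gt0.
  have lim : (fun n => 2%:R * harmonic n : R) @ \oo --> (0 : R).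
    by rewrite -[X in _ --> X](mulr0 2%:R); apply: cvgMr; exact: cvg_harmonic.
  apply: cvg_trans lim; apply: near_eq_cvg.
  by exists n0 => // n /= nn; rewrite /eps ltnNge nn.
move=> n phi D phi0 supp dens d T P X law indep good.
have mgood : measurable good by exact: measurable_terminates.
split=> //; rewrite /eps; case: ltnP => [_|nn0].
  by rewrite subrr measure_ge0.
have n20 : (2 ^ 20 <= n)%N by apply: leq_trans nn0; exact: leq_maxl.
have n_gt1 : (32 <= n)%N.
  by apply: leq_trans n20; rewrite -[32%N]/(2 ^ 5)%N leq_exp2l.
have n_gt0 : (0 < n)%N by apply: leq_trans n_gt1.
have ln1 : 1 <= ln (n%:R : R).
  rewrite -[leLHS](expRK 1) ler_ln ?posrE ?expR_gt0 ?ltr0n //; apply: ltW.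
  apply: lt_le_trans (truncnS_gt _) _; rewrite ler_nat.
  by apply: leq_trans nn0; exact: leq_maxr.
have [nK KL Kn] := top_scaleP n20.
have K_gt0 : (0 < top_scale n)%N by [].
have [e0 _] : exists e : edge n, true.
  have u0 : (0 < n)%N by []. have u1 : (1 < n)%N by apply: leq_trans n_gt1.
  have e2 : #|[set Ordinal u0; Ordinal u1]%SET| == 2%N by rewrite cards2.
  by exists (exist (fun e : {set 'I_n} => #|e| == 2%N) _ e2).
(* Some edge exists because [n] is at least 2, and one edge suffices to bound [phi] from below. *)
have phi1 := density_ge_half (supp e0) (dens e0).
apply: le_trans (good_probability phi0 supp dens law indep n_gt0 K_gt0 nK _); last first.
  apply: le_trans (step_count_bound phi0 n_gt0 K_gt0 phi1 n_gt1 KL) _.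
  rewrite ler_pM2l // -powR_mulrn //; apply: ler_powR; first by rewrite ler1n.
  exact: exponent_bound.
rewrite lee_fin lerD2l lerN2 /harmonic /=.
rewrite ler_pdivrMr ?ltr0n ?muln_gt0 ?expn_gt0 ?n_gt0 // mulrAC ler_pdivlMr ?ltr0n //.
rewrite -!natrM ler_nat.
by apply: leq_trans (leq_mul Kn (leqnn n.+1)) _; nia.
Qed.
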